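(* Let $a_0,a_1,c_0,c_1$ be non-negative integers, $a=a_0+a_1$, $c=c_0+c_1$. Let $\alpha,\beta\in\binom{[a]}{a_1}$, $\gamma,\delta\in\binom{[c]}{c_1}$ and $\nu\in\binom{[a+c]}{a_1+c_1}$. Then the number $\mathrm{Tri}(\alpha\gamma,\nu,\delta\beta)$ of triangular puzzles with boundary labels $\alpha\gamma,\nu,\delta\beta$ is $$\mathrm{Tri}(\alpha\gamma,\nu,\delta\beta)=\sum_{\lambda,\mu}c_{\lambda^!,\mu^!}^{\nu}\cdot c_{\alpha,\lambda}^{\beta^\vee}\cdot c_{\gamma,\mu}^{\delta^\vee},$$ where the sum is over $\lambda\in\binom{[a]}{a_1}$ and $\mu\in\binom{[c]}{c_1}$.
   Context: Strings: $\binom{[n]}{k}$ denotes the set of binary strings (words in $0,1$) of length $n$ with exactly $k$ ones; juxtaposition is concatenation; $\lambda^\vee$ is the reversal of $\lambda$. Littlewood-Richardson numbers: for $\lambda,\mu,\nu\in\binom{[n]}{k}$, $c_{\lambda,\mu}^\nu$ is defined by $[X_\lambda][X_\mu]=\sum_{\nu\in\binom{[n]}{k}}c_{\lambda,\mu}^\nu[X_\nu]$ in $H^*(\mathrm{Gr}(k;\mathbb{C}^n))$, where $X_\lambda=\{V:\dim(V\cap\langle e_1,\dots,e_i\rangle)\ge\lambda_1+\dots+\lambda_i\ \forall i\}$ is a Schubert variety. Equivalently it is the usual Littlewood-Richardson coefficient of the partitions attached to the strings, the partition of $\lambda$ having as its $j$-th part the number of $0$s to the right of the $j$-th $1$ in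 $\lambda$. Padding: if $\nu$ has $n_0$ zeros and $n_1$ ones, $\lambda$ has $l_0\le n_0$ zeros and $l_1\le n_1$ ones, and $\mu$ has $m_0\le n_0$ zeros and $m_1\le n_1$ ones, then $c_{\lambda^!,\mu^!}^\nu:=c_{0^{n_0-l_0}\lambda1^{n_1-l_1},\,0^{n_0-m_0}\mu1^{n_1-m_1}}^\nu$. Puzzles: work in the triangular lattice in the plane, whose unit edges make angles $0^\circ,60^\circ,120^\circ$ with the $x$-axis. Edge labels are the three symbols $0$, $1$, $10$ (where $10$ is a single symbol). A unit triangle (upward- or downward-pointing) with labeled edges is an allowed piece if its three labels read clockwise are $(0,0,0)$, $(1,1,1)$, or a cyclic rotation of $(1,0,10)$. Given a convex lattice polygon (sides along lattice directions) each of whose sides is labeled by a binary string, one symbol per unit edge, read clockwise around the polygon, a puzzle with this boundary is an assignment of labels to all unit lattice edges in the polygon which agrees with the prescribed labels on the boundary and for which every unit triangle in the polygon is an allowed piece. $\mathrm{Tri}(\lambda,\mu,\nu)$ is the number of puzzles on the upward-pointing equilateral triangle whose NW, NE and South sides, each read clockwise (so the South side is read right to left), are labeled $\lambda,\mu,\nu$. *)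

(* Defs.v *)
(* Mathematical Components, with multinomials for Schur polynomials. *)
From HB Require Import structures.
From mathcomp Require Import all_boot all_order all_algebra.
From mathcomp Require Import mpoly.
From Stdlib Require Import ClassicalEpsilon.

Set Implicit Arguments.
Unset Strict Implicit.
Unset Printing Implicit Defensive.

Import GRing.Theory.
Local Open Scope ring_scope.

(* Binary strings: the symbol 0 is [false], the symbol 1 is [true]. *)

Definition strings (n k : nat) : {set n.-tuple bool} :=
  [set s : n.-tuple bool | count id s == k].

Definition ones (s : seq bool) : nat := count id s.
Definition zeros (s : seq bool) : nat := count negb s.

(* Zero parts are kept: a string with k ones has a partition with exactly k
   parts. *)
Fixpoint string_partition (s : seq bool) : seq nat :=
  match s with
  | [::] => [::]
  | true :: s' => zeros s' :: string_partition s'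
  | false :: s' => string_partition s'
  end.

(* Partitions are weakly decreasing sequences of naturals, possibly with
   trailing zeros. The cell in row i and column j is [Tagged _ j], with tag i. *)
Definition cell (la : seq nat) : finType :=
  {i : 'I_(size la) & 'I_(nth 0%N la i)}.

Definition semistandard (N : nat) (la : seq nat)
    (T : {ffun cell la -> 'I_N}) : bool :=
  [forall x : cell la, forall y : cell la,
     ((tag x == tag y) && (tagged x <= tagged y)%N ==> (T x <= T y)%N)
  && ((tag x < tag y)%N && (tagged x == tagged y :> nat) ==> (T x < T y)%N)].

Definition schur (N : nat) (la : seq nat) : {mpoly int[N]} :=
  \sum_(T : {ffun cell la -> 'I_N} | semistandard T)
    \prod_(x : cell la) 'X_(T x).

Definition is_partition (k d : nat) (nu : seq nat) : bool :=
  [&& size nu == k, sorted geq nu & sumn nu == d].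

(* A partition of d has parts at most d, so the sum below ranges over all the
   partitions of d with at most k parts, padded to length k. *)
Definition schur_expansion (k d : nat) (p : {mpoly int[k]})
    (c : seq nat -> int) : Prop :=
  (forall nu : seq nat, ~~ is_partition k d nu -> c nu = 0) /\
  p = \sum_(nu : k.-tuple 'I_d.+1 | is_partition k d (map val nu))
        c (map val nu) *: schur k (map val nu).

(* The Littlewood-Richardson coefficients, as structure constants of the ring
   of symmetric polynomials in k variables: s_la s_mu = \sum_nu c nu *: s_nu.
   The Schur polynomials s_nu, nu with at most k parts, form a Z-basis of this
   ring, so the family selected by [epsilon] exists and is unique whenever la
   and mu are partitions of length k. *)
Definition LR_partition (k : nat) (la mu nu : seq nat) : int :=
  epsilon (inhabits (fun _ : seq nat => 0 : int))
    (@schur_expansion k (sumn la + sumn mu)%N (schur k la * schur k mu)) nu.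

(* c_{la,mu}^nu, for strings with equal lengths and equal numbers of ones. *)
Definition LR (la mu nu : seq bool) : int :=
  LR_partition (ones nu)
    (string_partition la) (string_partition mu) (string_partition nu).

Definition pad (n0 n1 : nat) (la : seq bool) : seq bool :=
  nseq (n0 - zeros la) false ++ la ++ nseq (n1 - ones la) true.

(* c_{la^!,mu^!}^nu *)
Definition LR_pad (la mu nu : seq bool) : int :=
  LR (pad (zeros nu) (ones nu) la) (pad (zeros nu) (ones nu) mu) nu.

(* Puzzle labels: [Some b] is the symbol 0 or 1, [None] is the symbol 10. *)
Definition label : finType := option bool.
Definition lab0 : label := Some false.
Definition lab1 : label := Some true.
Definition lab10 : label := None.

(* l1, l2, l3 are read clockwise. *)
Definition allowed (l1 l2 l3 : label) : bool :=
  (l1, l2, l3) \in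
    [:: (lab0, lab0, lab0); (lab1, lab1, lab1);
        (lab1, lab0, lab10); (lab0, lab10, lab1); (lab10, lab1, lab0)].

(* In the lattice basis u = (angle 0), v = (angle 60), the upward triangle of
   size n has vertices 0, n u and n v. Each of its unit edges is a side of
   exactly one upward unit triangle, the one with lower left corner x u + y v,
   x + y < n; edges are indexed by this corner (x, y) and the angle:
     d = 0, angle 0   : from (x, y) to (x + 1, y)        (South side),
     d = 1, angle 60  : from (x, y) to (x, y + 1)        (NW side),
     d = 2, angle 120 : from (x + 1, y) to (x, y + 1)    (NE side). *)
Definition edge (n : nat) : finType :=
  {e : 'I_3 * ('I_n * 'I_n) | (e.2.1 + e.2.2 < n)%N}.

Definition edge_at (n : nat) (e : edge n) (d x y : nat) : bool :=
  [&& (val e).1 == d :> nat, (val e).2.1 == x :> nat & (val e).2.2 == y :> nat].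

Definition up_ok (n : nat) (P : {ffun edge n -> label}) : bool :=
  [forall x : 'I_n, forall y : 'I_n,
   forall e1 : edge n, forall e2 : edge n, forall e3 : edge n,
     [&& edge_at e1 1 x y, edge_at e2 2 x y & edge_at e3 0 x y] ==>
       allowed (P e1) (P e2) (P e3)].

(* The downward triangle with vertices (x, y + 1), (x + 1, y + 1), (x + 1, y):
   top, right and left sides. *)
Definition down_ok (n : nat) (P : {ffun edge n -> label}) : bool :=
  [forall x : 'I_n, forall y : 'I_n,
   forall e1 : edge n, forall e2 : edge n, forall e3 : edge n,
     [&& edge_at e1 0 x y.+1, edge_at e2 1 x.+1 y & edge_at e3 2 x y] ==>
       allowed (P e1) (P e2) (P e3)].

(* Clockwise, the NW side runs from (0, 0) to (0, n), the NE side from (0, n)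
   to (n, 0), and the South side from (n, 0) to (0, 0). *)
Definition boundary_ok (n : nat) (la mu nu : seq bool)
    (P : {ffun edge n -> label}) : bool :=
  [forall i : 'I_n, forall e : edge n,
     [&& edge_at e 1 0 i ==> (P e == Some (nth false la i)),
         edge_at e 2 i (n - i.+1) ==> (P e == Some (nth false mu i))
       & edge_at e 0 (n - i.+1) 0 ==> (P e == Some (nth false nu i))]].

(* The three strings must have the same length, the size of the triangle. *)
Definition Tri (la mu nu : seq bool) : nat :=
  #|[set P : {ffun edge (size la) -> label} |
      [&& size mu == size la, size nu == size la, boundary_ok la mu nu P,
          up_ok P & down_ok P]]|.

(* Main.v *)
Require Import Defs.
From mathcomp Require Import all_boot all_order all_algebra.
From mathcomp Require Import ring zify.
From mathcomp Require Import mpoly.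
From Stdlib Require Import ClassicalEpsilon.
Set Implicit Arguments.
Unset Strict Implicit.
Unset Printing Implicit Defensive.
Import GRing.Theory.
Local Open Scope ring_scope.

(* Adding a vertical or a horizontal strip to a string is a two-state transfer
   matrix, and chains of strips starting at the string [vac] of the empty
   partition generate the Schur polynomials; complementing and reversing the
   strings exchanges the two kinds of strips.

   A puzzle is a stack of rows of triangles. An auxiliary line with labels
   0, 1, 10 can be slid through a triangle (a relation of Yang-Baxter type), hence
   through a puzzle. When the line is frozen along the NW side, this says that
   adding a vertical strip to the NE side amounts to adding one to the South side.
   Starting from the NE side [vac], where puzzles are unique, the generating
   function of the vertical chains from [la] to [nu] is therefore the sum over [k]
   of the number of puzzles on [la], [k], [nu] times the generating function of the
   chains from [vac] to [k]. Comparing with the iterated Pieri rule for the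
   elementary symmetric functions, and using that Schur polynomials are linearly
   independent, puzzles compute the products of Schur polynomials.

   The strings [alpha gamma] and [beta^v delta^v] bound two disjoint skew shapes,
   so the vertical chains between them factor; expanding both factors, and then the
   product of the (conjugate) Schur polynomials that appear, gives the formula. *)

(** * Sums over words and transfer matrices *)

(** Strings live in a box, the 0s counting columns and the 1s counting rows, and truncation to the
    box spoils both the commutation of the two kinds of strips and the expansion of products.
    Leading 0s are free columns and trailing 1s are free rows, so identities are proved with enough
    of them and the padding is removed afterwards. Apart from the reflection, identities between
    numbers of puzzles are not proved by bijections: both sides are coefficients in an independent
    family of generating functions, and coefficients are compared. The weights of the sliding line
    contain the inverse of the parameter, so independence is tested at nonzero values only, over a
    field of characteristic 0, where these still suffice to kill a polynomial. The delicate product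
    is that of the two factors of the cut skew shape: its terms must be known to fit in the box of
    length [a + c]. A skew shape in two pieces itself supplies such an expansion, and only the
    coefficients remain to be identified. *)

Lemma sum_bool (R : nmodType) (F : bool -> R) : \sum_b F b = F true + F false.
Proof. exact: big_bool. Qed.

Section TupleSums.
Variables (R : nmodType) (A : finType).
Implicit Type F : seq A -> R.

Lemma sum_tuple0 F : \sum_(w : 0.-tuple A) F w = F [::].
Proof.
by rewrite (big_pred1 [tuple]) // => w; rewrite [w]tuple0; apply/esym/eqP.
Qed.

Lemma sum_tupleS n F :
  \sum_(w : n.+1.-tuple A) F w = \sum_a \sum_(w : n.-tuple A) F (a :: w).
Proof.
rewrite pair_big /=.
rewrite (reindex (fun p : A * n.-tuple A => [tuple of p.1 :: p.2])) //=.
exists (fun w : n.+1.-tuple A => (thead w, [tuple of behead w])) => [[a w]|w] _.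
  by congr (_, _); apply: val_inj.
by rewrite /= -tuple_eta.
Qed.

Lemma sum_tuple_rev n F :
  \sum_(w : n.-tuple A) F w = \sum_(w : n.-tuple A) F (rev w).
Proof.
rewrite (reindex_inj (h := fun w : n.-tuple A => [tuple of rev w])) //.
by apply: (can_inj (g := fun w : n.-tuple A => [tuple of rev w])) => w;
  apply: val_inj; rewrite /= revK.
Qed.

Lemma sum_tuple_rcons n F :
  \sum_(w : n.+1.-tuple A) F w
  = \sum_a \sum_(w : n.-tuple A) F (rcons w a).
Proof.
rewrite sum_tuple_rev (sum_tupleS _ (fun w => F (rev w))).
apply: eq_bigr => a _; rewrite (sum_tuple_rev _ (fun w => F (rcons w a))).
by apply: eq_bigr => w _; rewrite rev_cons.
Qed.

Lemma sum_tuple_cat m n F :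
  \sum_(w : (m + n).-tuple A) F w
  = \sum_(u : m.-tuple A) \sum_(v : n.-tuple A) F (u ++ v).
Proof.
elim: m F => [|m IH] F; first by rewrite (sum_tuple0 (fun u => \sum_(v : n.-tuple A) F (u ++ v))).
rewrite (sum_tupleS (m + n) F) (sum_tupleS m (fun u => \sum_(v : n.-tuple A) F (u ++ v))).
by apply: eq_bigr => a _; rewrite (IH (fun w => F (a :: w))).
Qed.

Lemma sum_tuple_map n (f : A -> A) F : involutive f ->
  \sum_(w : n.-tuple A) F w = \sum_(w : n.-tuple A) F (map f w).
Proof.
move=> fK.
rewrite (reindex_inj (h := fun w : n.-tuple A => [tuple of map f w])) //.
by apply: (can_inj (g := fun w : n.-tuple A => [tuple of map f w])) => w;
  apply: val_inj; rewrite /= (mapK fK).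
Qed.

End TupleSums.

Lemma sum_tuple_delta (R : pzSemiRingType) (A : finType) n (F : seq A -> R)
    (u : seq A) : size u = n ->
  \sum_(w : n.-tuple A) (u == w)%:R * F w = F u.
Proof.
move/eqP=> su; rewrite (bigD1 (Tuple su)) //= eqxx mul1r big1 ?addr0 // => w nw.
rewrite (_ : (u == w) = false) ?mul0r //.
by apply: contra_neqF nw => /eqP uw; apply: val_inj.
Qed.

Section Automata.
Variables (R : comNzRingType) (K A B : finType).
Implicit Type L : K -> A -> B -> K -> R.

(** An entry of a product of transfer matrices: the total weight of the state paths from [i] to [j]
    that read [u] and [v] in parallel. *)
Fixpoint aut L (i : K) (u : seq A) (v : seq B) (j : K) : R :=
  match u, v with
  | [::], [::] => (i == j)%:R
  | x :: u', y :: v' => \sum_m L i x y m * aut L m u' v' j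
  | _, _ => 0
  end.

Lemma aut_size L i u v j : size u != size v -> aut L i u v j = 0.
Proof.
elim: u v i => [|x u IH] [|y v] //= i; rewrite eqSS => suv.
by rewrite big1 // => m _; rewrite IH ?mulr0.
Qed.

Lemma aut_cat L i u u' v v' j : size u = size v ->
  aut L i (u ++ u') (v ++ v') j = \sum_m aut L i u v m * aut L m u' v' j.
Proof.
elim: u v i => [|x u IH] [|y v] //= i.
  by rewrite (bigD1 i) //= eqxx mul1r big1 ?addr0 // => m /negbTE;
    rewrite eq_sym => ->; rewrite mul0r.
case=> suv; under eq_bigr => m _ do rewrite IH // mulr_sumr.
rewrite exchange_big; apply: eq_bigr => m _; rewrite mulr_suml.
by apply: eq_bigr => n _; rewrite mulrA.
Qed.

Lemma aut1 L i x y j : aut L i [:: x] [:: y] j = L i x y j.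
Proof.
by rewrite /= (bigD1 j) //= eqxx mulr1 big1 ?addr0 // => m /negbTE ->;
  rewrite mulr0.
Qed.

Lemma aut_rcons L i u x v y j :
  aut L i (rcons u x) (rcons v y) j = \sum_m aut L i u v m * L m x y j.
Proof.
case: (eqVneq (size u) (size v)) => suv.
  by rewrite -!cats1 aut_cat //; under eq_bigr => m _ do rewrite aut1.
rewrite aut_size ?size_rcons ?eqSS // big1 // => m _.
by rewrite aut_size ?mul0r.
Qed.

Lemma aut_rev L i u v j :
  aut L i (rev u) (rev v) j = aut (fun i x y j => L j x y i) j u v i.
Proof.
elim: u v j => [|x u IH] [|y v] j; rewrite ?rev_cons.
- by rewrite /= eq_sym.
- by rewrite aut_size // size_rcons.
- by rewrite aut_size // size_rcons.
rewrite aut_rcons /=; apply: eq_bigr => m _; by rewrite IH mulrC.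
Qed.

End Automata.

Section AutomataCompose.
Variables (R : comNzRingType) (K1 K2 A B C : finType).
Variables (L1 : K1 -> A -> B -> K1 -> R) (L2 : K2 -> B -> C -> K2 -> R).

Lemma aut_swap i u v j :
  aut L1 i u v j = aut (fun i y x j => L1 i x y j) i v u j.
Proof.
by elim: u v i => [|x u IH] [|y v] //= i; apply: eq_bigr => m _; rewrite IH.
Qed.

Definition comp_aut (i : K1 * K2) (x : A) (z : C) (j : K1 * K2) : R :=
  \sum_y L1 i.1 x y j.1 * L2 i.2 y z j.2.

(** Summing out the middle word letter by letter is a matrix product on pairs of states. *)
Lemma aut_comp n i u v j : size u = n -> size v = n ->
  \sum_(w : n.-tuple B) aut L1 i.1 u w j.1 * aut L2 i.2 w v j.2
  = aut comp_aut i u v j.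
Proof.
elim: u v n i => [|x u IH] [|z v] [|n] //= i.
  move=> _ _; rewrite (sum_tuple0 (fun w => aut L1 i.1 [::] w j.1 * aut L2 i.2 w [::] j.2)) /=.
  by case: i j => i1 i2 [j1 j2]; rewrite xpair_eqE /= -natrM mulnb.
move=> [su] [sv].
rewrite (sum_tupleS n (fun w => aut L1 i.1 (x :: u) w j.1 * aut L2 i.2 w (z :: v) j.2)).
transitivity (\sum_m1 \sum_m2 comp_aut i x z (m1, m2) * aut comp_aut (m1, m2) u v j); last first.
  by rewrite pair_bigA; apply: eq_bigr => -[].
under [RHS]eq_bigr => m1 _ do under eq_bigr => m2 _ do
  rewrite -(IH v n (m1, m2) su sv) /comp_aut mulr_suml /=.
under [RHS]eq_bigr => m1 _ do rewrite exchange_big /=.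
rewrite [RHS]exchange_big /=; apply: eq_bigr => y _.
under eq_bigr => w _ do rewrite mulr_suml.
rewrite exchange_big /=; apply: eq_bigr => m1 _.
under eq_bigr => w _ do rewrite mulr_sumr.
rewrite exchange_big /=; apply: eq_bigr => m2 _.
rewrite mulr_sumr; apply: eq_bigr => w _; ring.
Qed.

End AutomataCompose.

(** The train argument: a local exchange relation is pushed through the words one letter at a
    time. *)
Lemma aut_intertwine (R : comNzRingType) (K K' A B : finType)
    (P : K -> A -> B -> K -> R) (Q : K' -> A -> B -> K' -> R) (r : K -> K' -> R) :
  (forall i x z j, \sum_k P i x z k * r k j = \sum_k r i k * Q k x z j) ->
  forall i u v j,
    \sum_k aut P i u v k * r k j = \sum_k r i k * aut Q k u v j.
Proof.
move=> PQ i u v j; elim: u v i => [|x u IH] [|z v] i /=.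
- rewrite (bigD1 i) //= eqxx mul1r big1 ?addr0; last first.
    by move=> k /negbTE; rewrite eq_sym => ->; rewrite mul0r.
  rewrite (bigD1 j) //= eqxx mulr1 big1 ?addr0 //.
  by move=> k /negbTE ->; rewrite mulr0.
- by rewrite !big1 // => k _; rewrite ?mul0r ?mulr0.
- by rewrite !big1 // => k _; rewrite ?mul0r ?mulr0.
under eq_bigr => k _ do rewrite mulr_suml.
rewrite exchange_big /=.
under eq_bigr => m _.
  under eq_bigr => k _ do rewrite -mulrA.
  rewrite -mulr_sumr IH mulr_sumr.
  under eq_bigr => k _ do rewrite mulrA.
  over.
rewrite exchange_big /=.
under eq_bigr => m _ do rewrite -mulr_suml PQ mulr_suml.
rewrite exchange_big /=; apply: eq_bigr => k _.
by rewrite mulr_sumr; apply: eq_bigr => m _; rewrite mulrA.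
Qed.

(** * Vertical and horizontal strips *)

(** [star] conjugates the partition of a string; [vac z k] is the empty partition in the box with
    [k] rows and [z] columns. *)
Definition star (w : seq bool) : seq bool := rev (map negb w).
Definition vac (z k : nat) : seq bool := nseq z false ++ nseq k true.

Lemma size_star w : size (star w) = size w.
Proof. by rewrite size_rev size_map. Qed.

Lemma starK : involutive star.
Proof. by move=> w; rewrite /star map_rev revK mapK //; apply: negbK. Qed.

Lemma star_cat u v : star (u ++ v) = star v ++ star u.
Proof. by rewrite /star map_cat rev_cat. Qed.

Lemma star_nseq n b : star (nseq n b) = nseq n (~~ b).
Proof. by rewrite /star map_nseq rev_nseq. Qed.

Lemma star_vac z k : star (vac z k) = vac k z.
Proof. by rewrite star_cat !star_nseq. Qed.

Lemma size_vac z k : size (vac z k) = (z + k)%N.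
Proof. by rewrite size_cat !size_nseq. Qed.

Lemma ones_zeros w : (ones w + zeros w)%N = size w.
Proof. by rewrite /ones /zeros -(count_predC id w). Qed.

Lemma ones_cat u v : ones (u ++ v) = (ones u + ones v)%N.
Proof. exact: count_cat. Qed.

Lemma zeros_cat u v : zeros (u ++ v) = (zeros u + zeros v)%N.
Proof. exact: count_cat. Qed.

Lemma ones_nseq n b : ones (nseq n b) = (b * n)%N.
Proof. exact: count_nseq. Qed.

Lemma zeros_nseq n b : zeros (nseq n b) = (~~ b * n)%N.
Proof. exact: count_nseq. Qed.

Lemma ones_star w : ones (star w) = zeros w.
Proof. by rewrite /ones /star count_rev count_map. Qed.

Lemma ones_vac z k : ones (vac z k) = k.
Proof. by rewrite ones_cat !ones_nseq mul0n mul1n. Qed.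

Lemma vac_rcons z k : vac z k.+1 = rcons (vac z k) true.
Proof. by rewrite -cats1 /vac -catA -[[:: true]]/(nseq 1 true) -nseqD addn1. Qed.

Lemma sum_star (R : nmodType) n (F : seq bool -> R) :
  \sum_(w : n.-tuple bool) F w = \sum_(w : n.-tuple bool) F (star w).
Proof.
rewrite sum_tuple_rev (sum_tuple_map (f := negb) n (fun w => F (rev w))) //.
exact: negbK.
Qed.

Lemma sum_neq0 (R : nmodType) (I : finType) (F : I -> R) :
  \sum_i F i != 0 -> exists i, F i != 0.
Proof.
move=> H; apply/existsP; apply: contraNT H => /existsPn H; apply/eqP.
by apply: big1 => i _; apply/eqP; have:= H i; rewrite negbK.
Qed.

Lemma mulf_neq0_pz (R : pzSemiRingType) (x y : R) : x * y != 0 -> x != 0 /\ y != 0.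
Proof.
by move=> H; split; apply: contraNneq H => ->; rewrite ?mul0r ?mulr0.
Qed.

Section Strips.
Variable R : comNzRingType.
Implicit Types (x t : R) (u v w a b : seq bool).

(* State [true]: a 1 of the larger partition has been read whose partner in the
   smaller one is still to come. *)
Definition hstrip_step x (i u w j : bool) : R :=
  match i, u, w, j with
  | false, false, false, false => 1
  | false, true, true, false => 1
  | false, false, true, true => x
  | true, false, false, true => x
  | true, true, false, false => 1
  | _, _, _, _ => 0
  end.

(** Conjugation reads the strings backwards, so the incoming and the outgoing state are exchanged as
    well. *)
Definition vstrip_step t (i v u j : bool) : R :=
  hstrip_step t j (~~ v) (~~ u) i.

Definition hstrip x u w : R := aut (hstrip_step x) false u w false.
Definition vstrip t v u : R := aut (vstrip_step t) false v u false.

Lemma vstrip_star t v u : vstrip t v u = hstrip t (star v) (star u).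
Proof.
rewrite /hstrip /vstrip /star aut_rev.
move: false {1 3}false => i j.
elim: v u j => [|y v IH] [|z u] //= j.
by apply: eq_bigr => m _; rewrite IH.
Qed.

(** A strip moves 1s to the left: a 0 at the front of the larger string, and likewise a 1 at its
    end, must already be there in the smaller one. *)
Lemma hstrip_cons0 x (b : bool) u w :
  hstrip x (b :: u) (false :: w) = (~~ b)%:R * hstrip x u w.
Proof. by rewrite /hstrip /= sum_bool; case: b; rewrite /= !mul0r ?addr0 ?add0r. Qed.

Lemma hstrip_rcons1 x (b : bool) u w :
  hstrip x (rcons u b) (rcons w true) = b%:R * hstrip x u w.
Proof.
rewrite /hstrip aut_rcons sum_bool /=.
by case: b; rewrite /= ?mulr0 ?add0r ?mulr1 ?mul1r ?mul0r // addr0.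
Qed.

Lemma hstrip0 u w : hstrip 0 u w = (u == w)%:R.
Proof.
rewrite /hstrip; elim: u w => [|[] u IH] [|[] w] //=;
  by rewrite sum_bool /= ?IH !(mul0r, mul1r, add0r, addr0).
Qed.

Lemma hstrip_ones x u w : hstrip x u w != 0 -> ones u = ones w.
Proof.
suff: forall i, aut (hstrip_step x) i u w false != 0 -> ones u = (i + ones w)%N.
  by move=> /(_ false).
elim: u w => [|[] u IH] [|[] w] [] //=; rewrite ?eqxx // sum_bool /=;
  rewrite ?mul0r ?mul1r ?add0r ?addr0 ?eqxx //.
- by move/IH => /=; rewrite /ones /= => ->.
- by move/IH => /=; rewrite /ones /= => ->.
- by have [->|/IH /=] := eqVneq (aut (hstrip_step x) true u w false) 0;
    rewrite ?mulr0 ?eqxx // /ones /= => ->.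
- by have [->|/IH /=] := eqVneq (aut (hstrip_step x) true u w false) 0;
    rewrite ?mulr0 ?eqxx // /ones /= => ->.
- by move/IH.
Qed.

Lemma hstrip_vac x u z k : size u = (z + k)%N ->
  hstrip x u (vac z k) = (u == vac z k)%:R.
Proof.
elim: z u => [|z IH] u.
  rewrite /vac /= add0n; elim: k u => [|k IH] u.
    by case: u => //= _; rewrite /hstrip /= eqxx.
  rewrite -addn1 nseqD cats1 addn1; case/lastP: u => // u b.
  rewrite size_rcons => -[su]; rewrite hstrip_rcons1 IH // eqseq_rcons.
  by case: b; rewrite /= ?andbT ?andbF ?mul1r ?mul0r.
case: u => [|b u] //= [su]; rewrite hstrip_cons0 -/(vac z k) IH //.
by rewrite eqseq_cons; case: b; rewrite /= ?mul0r ?mul1r.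
Qed.

Lemma vstrip_vac t v z k : size v = (z + k)%N ->
  vstrip t v (vac z k) = (v == vac z k)%:R.
Proof.
move=> sv; rewrite vstrip_star star_vac hstrip_vac ?size_star ?sv 1?addnC //.
by rewrite -(inj_eq (inv_inj starK)) starK star_vac.
Qed.

(** The head of [xs] is the weight of the last strip added, so unfolding peels off the outermost
    variable. *)
Fixpoint chain (n : nat) (M : R -> seq bool -> seq bool -> R) (xs : seq R) a b : R :=
  match xs with
  | [::] => (a == b)%:R
  | x :: xs' => \sum_(c : n.-tuple bool) chain n M xs' a c * M x c b
  end.

Lemma chain_star n xs a b :
  chain n vstrip xs a b = chain n hstrip xs (star a) (star b).
Proof.
elim: xs b => [|x xs IH] b /=; first by rewrite (inj_eq (inv_inj starK)).
rewrite [RHS](sum_star _ (fun c => chain n hstrip xs (star a) c * hstrip x c (star b))).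
by apply: eq_bigr => c _; rewrite IH vstrip_star.
Qed.

(* A horizontal strip adds at most one nonzero part. *)
Lemma hstrip_trailing x u w r :
  hstrip x (u ++ nseq r.+1 true) w != 0 -> exists w', w = w' ++ nseq r true.
Proof.
rewrite /hstrip; move: {1}false => i.
elim: u w i => [|b u IH] w i /=.
  case: w => [|b w] //=; first by rewrite eqxx.
  (* With no 1 pending, a run of 1s in the smaller string can only be copied. *)
  have ru m v : aut (hstrip_step x) m (nseq r true) v false != 0 -> m = false -> v = nseq r true.
    move=> + m0; rewrite m0 => {m0 m}.
    elim: r v => [|r IH] [|[] v] //=; rewrite ?eqxx // sum_bool /= !mul0r add0r ?eqxx //.
    by rewrite mul1r => /IH ->.
  rewrite sum_bool /=; case: i b => [] [] /=; rewrite ?mul0r ?add0r ?addr0 ?mul1r ?eqxx //.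
    by move/ru => -> //; exists [:: false].
  by move/ru => -> //; exists [:: true].
case: w => [|c w] /=; first by rewrite eqxx.
by case/sum_neq0 => m /mulf_neq0_pz[_ /IH[w' ->]]; exists (c :: w').
Qed.

Lemma chain_trailing n xs a b r :
  chain n hstrip xs (a ++ nseq (size xs + r) true) b != 0 ->
  exists b', b = b' ++ nseq r true.
Proof.
elim: xs r b => [|x xs IH] r b.
  by rewrite /=; case: (_ =P b) => [<- _|_]; [exists a | rewrite eqxx].
rewrite [size _]/= addSnnS => /sum_neq0[c /mulf_neq0_pz[Hc Hb]].
by have [c' Ec] := IH _ _ Hc; rewrite Ec in Hb; apply: hstrip_trailing Hb.
Qed.

Lemma chain_leading n ts a b r :
  chain n vstrip ts (nseq (size ts + r) false ++ a) b != 0 ->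
  exists b', b = nseq r false ++ b'.
Proof.
rewrite chain_star star_cat star_nseq => /chain_trailing [b' Eb].
by exists (star b'); rewrite -[b]starK Eb star_cat star_nseq.
Qed.

Lemma chain_rcons1 n xs a w :
  chain n.+1 hstrip xs (rcons a true) (rcons w true) = chain n hstrip xs a w.
Proof.
elim: xs w => [|x xs IH] w /=; first by rewrite eqseq_rcons andbT.
rewrite (sum_tuple_rcons _ (fun c => chain n.+1 hstrip xs (rcons a true) c
   * hstrip x c (rcons w true))) sum_bool /=.
rewrite [X in _ + X]big1 ?addr0; last first.
  by move=> c _; rewrite hstrip_rcons1 mul0r mulr0.
by apply: eq_bigr => c _; rewrite IH hstrip_rcons1 mul1r.
Qed.

Lemma chain_cons0 n xs a w :
  chain n.+1 hstrip xs (false :: a) (false :: w) = chain n hstrip xs a w.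
Proof.
elim: xs w => [|x xs IH] w //=.
rewrite (sum_tupleS _ (fun c => chain n.+1 hstrip xs (false :: a) c
   * hstrip x c (false :: w))) sum_bool /=.
rewrite [X in X + _]big1 ?add0r; last first.
  by move=> c _; rewrite hstrip_cons0 mul0r mulr0.
by apply: eq_bigr => c _; rewrite IH hstrip_cons0 mul1r.
Qed.

Lemma chain_cat1 n k xs a w :
  chain (n + k) hstrip xs (a ++ nseq k true) (w ++ nseq k true) = chain n hstrip xs a w.
Proof.
elim: k => [|k IH]; first by rewrite !cats0 addn0.
have nseqS u : u ++ nseq k.+1 true = rcons (u ++ nseq k true) true.
  by rewrite -cats1 -catA -[[:: true]]/(nseq 1 true) -nseqD addn1.
by rewrite addnS !nseqS chain_rcons1.
Qed.

Lemma chain_cat0 n k xs a w :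
  chain (k + n) hstrip xs (nseq k false ++ a) (nseq k false ++ w) = chain n hstrip xs a w.
Proof. by elim: k => [|k IH] //; rewrite addSn /= chain_cons0. Qed.

Lemma vchain_cat0 n k xs a w :
  chain (k + n) vstrip xs (nseq k false ++ a) (nseq k false ++ w) = chain n vstrip xs a w.
Proof.
by rewrite !chain_star !star_cat !star_nseq addnC chain_cat1.
Qed.

Lemma vchain_cat1 n k xs a w :
  chain (n + k) vstrip xs (a ++ nseq k true) (w ++ nseq k true) = chain n vstrip xs a w.
Proof.
by rewrite !chain_star !star_cat !star_nseq addnC chain_cat0.
Qed.

Lemma chain_vac n xs z k : n = (z + k)%N ->
  chain n hstrip xs (vac z k) (vac z k) = 1.
Proof.
move=> ->; elim: xs => [|x xs IH] /=; first by rewrite eqxx.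
rewrite -[RHS]IH -(sum_tuple_delta (chain _ _ _ _) (size_vac z k)).
apply: eq_bigr => c _; rewrite hstrip_vac ?size_tuple // eq_sym.
exact: mulrC.
Qed.

Lemma chain_ones n xs a b : chain n hstrip xs a b != 0 -> ones a = ones b.
Proof.
elim: xs b => [|x xs IH] b /=; first by case: (a =P b) => [->|]; rewrite ?eqxx.
case/sum_neq0 => c /mulf_neq0_pz[Hc Hb].
by rewrite (IH _ Hc) (hstrip_ones Hb).
Qed.

End Strips.

(** * Linear independence and the Pieri rule *)

Lemma nseq_rcons (T : Type) n (x : T) : nseq n.+1 x = rcons (nseq n x) x.
Proof. by elim: n => //= n ->. Qed.

(** The Schur polynomial of a partition with more nonzero parts than variables vanishes. *)
Lemma chain_ends1 (R : comNzRingType) n xs z k (u : seq bool) :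
  (size xs < k)%N -> chain (R := R) n (@hstrip R) xs (vac z k) u != 0 ->
  exists u', u = rcons u' true.
Proof.
move=> ltk; rewrite /vac -{1}(subnKC (ltnW ltk)) => /chain_trailing[u' ->].
by rewrite -(prednK (n := (k - size xs)%N)) ?subn_gt0 // nseq_rcons -rcons_cat; eexists.
Qed.

(* Multiplication by all the variables adds a column. *)
Lemma chain_rcons0 (R : comNzRingType) n (xs : seq R) z k w :
  size xs = k -> n = (z + k)%N -> size w = n ->
  chain n.+1 (@hstrip R) xs (vac z.+1 k) (rcons w false)
  = \prod_(x <- xs) x * chain n (@hstrip R) xs (vac z k) w.
Proof.
elim: xs n k w => [|x xs IH] n k w /=.
  move=> <- -> sw; rewrite big_nil mul1r /vac !cats0.
  by rewrite nseq_rcons eqseq_rcons andbT.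
case: k => // k [sxs] En sw; case: n En sw => [|n]; first by rewrite addnS.
rewrite addnS => -[En] sw.
have ltk : (size xs < k.+1)%N by rewrite sxs.
rewrite (sum_tuple_rcons _ (fun c => chain n.+2 (@hstrip R) xs (vac z.+1 k.+1) c
  * hstrip x c (rcons w false))) sum_bool /=.
rewrite [X in _ + X]big1 ?addr0; last first.
  move=> c _; apply/eqP; apply: contraT => /mulf_neq0_pz[/(chain_ends1 ltk)[u]].
  by move/eqP; rewrite eqseq_rcons andbF.
rewrite (sum_tuple_rcons _ (fun c => chain n.+1 (@hstrip R) xs (vac z k.+1) c
  * hstrip x c w)) sum_bool /=.
rewrite [X in _ + X]big1 ?addr0; last first.
  move=> c _; apply/eqP; apply: contraT => /mulf_neq0_pz[/(chain_ends1 ltk)[u]].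
  by move/eqP; rewrite eqseq_rcons andbF.
rewrite (sum_tuple_rcons _ (fun c => chain n.+2 (@hstrip R) xs (vac z.+1 k.+1) (rcons c true)
  * hstrip x (rcons c true) (rcons w false))) sum_bool /=.
(* The final 1 is still pending when the last letter is read, which forces [b] to be 0; dropping
   that column costs one factor [x]. *)
have hE c b : size c = n -> hstrip x (rcons (rcons c b) true) (rcons w false)
    = (~~ b)%:R * x * hstrip x (rcons c true) w.
  case/lastP: w sw => // w d; rewrite size_rcons => -[sw] sc.
  rewrite /hstrip aut_rcons sum_bool /= ?mulr0 ?mulr1 ?addr0 !aut_rcons !sum_bool.
  by case: b d => [] []; rewrite /= ?mulr0 ?mul0r ?mulr1 ?mul1r ?add0r ?addr0 //; ring.
rewrite [X in X + _]big1 ?add0r; last first.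
  by move=> c _; rewrite hE ?size_tuple // !mul0r mulr0.
rewrite big_cons mulr_sumr; apply: eq_bigr => c _.
rewrite hE ?size_tuple //= mul1r !vac_rcons !chain_rcons1 (IH n k) ?size_tuple //.
by ring.
Qed.

Lemma horner_hstrip (R : comNzRingType) (x : R) u w :
  (hstrip 'X u w).[x] = hstrip x u w.
Proof.
rewrite /hstrip; move: {1 3}false => i.
elim: u w i => [|a u IH] [|b w] i /=; rewrite ?horner0 //.
  by rewrite -polyC_natr hornerC.
rewrite !sum_bool hornerD !hornerM !IH.
by case: i a b => [] [] []; rewrite /= ?hornerX ?hornerC.
Qed.

(** The images of the positive integers are already too many roots. *)
Lemma poly_eq0_nonzero (F : fieldType) (p : {poly F}) :
  (forall n, n.+1%:R != 0 :> F) -> (forall x, x != 0 -> p.[x] = 0) -> p = 0.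
Proof.
move=> F0 H; apply/eqP; apply: contraT => p0.
have inj : injective (fun i : nat => i.+1%:R : F).
  have lt i j : (i < j)%N -> i.+1%:R != j.+1%:R :> F.
    move=> ij; rewrite eq_sym -subr_eq0 -natrB ?ltnS 1?ltnW // subSS.
    by rewrite -(prednK (n := (j - i)%N)) ?subn_gt0 // F0.
  move=> i j /eqP E; apply/eqP; move: E; apply: contraTT; rewrite neq_ltn.
  by case/orP => /lt //; rewrite eq_sym.
pose rs := [seq i.+1%:R : F | i <- iota 0 (size p)].
have: (size rs < size p)%N.
  apply: max_poly_roots p0 _ _; last by rewrite map_inj_uniq ?iota_uniq.
  by apply/allP => _ /mapP[i _ ->]; apply/rootP/H/F0.
by rewrite size_map size_iota ltnn.
Qed.

Section Freeness.
Variable F : fieldType.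
Hypothesis F_char0 : forall n, n.+1%:R != 0 :> F.

(* Setting the outermost variable to 0 keeps only the strings ending in 1; the
   remaining strings have a common factor, the product of all the variables. *)
Lemma chain_free n z k (c : seq bool -> F) : n = (z + k)%N ->
  (forall w, ones w != k -> c w = 0) ->
  (forall xs, size xs = k -> all (predC1 0) xs ->
     \sum_(w : n.-tuple bool) c w * chain n (@hstrip F) xs (vac z k) w = 0) ->
  forall w, size w = n -> c w = 0.
Proof.
elim: n z k c => [|n IH] z k c En c0 Hc w.
  case: w => // _.
  have [z0 k0] : z = 0%N /\ k = 0%N by case: z k {c0 Hc} En => [|z] [].
  by subst k z; have := Hc [::] erefl erefl; rewrite (sum_tuple0 (fun w => c w * chain 0 (@hstrip F) [::] (vac 0 0) w)) /= mulr1.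
have c1 u : size u = n -> c (rcons u true) = 0.
  move=> su; case: k c0 En Hc => [|k] c0 En Hc.
    by apply: c0; rewrite -cats1 ones_cat addn1.
  have {}En : n = (z + k)%N by move: En; rewrite addnS => -[].
  apply: (IH z k (fun v => c (rcons v true)) En _ _ _ su) => [v nv | xs sxs xs0].
    by apply: c0; rewrite -cats1 ones_cat addn1.
  (* The relation as a polynomial in the outermost variable: it vanishes at nonzero values, hence
     also at 0, where the hypothesis does not apply. *)
  pose p := \sum_(w : n.+1.-tuple bool) \sum_(v : n.+1.-tuple bool)
     (c w * chain n.+1 (@hstrip F) xs (vac z k.+1) v) *: hstrip 'X v w.
  have pE x : p.[x] = \sum_(w : n.+1.-tuple bool)
      c w * chain n.+1 (@hstrip F) (x :: xs) (vac z k.+1) w.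
    rewrite horner_sum; apply: eq_bigr => v _ /=.
    rewrite horner_sum mulr_sumr; apply: eq_bigr => v' _.
    by rewrite hornerZ horner_hstrip mulrA.
  have p0 : p = 0.
    apply: poly_eq0_nonzero => // x x0; rewrite pE Hc //= ?sxs //.
    by rewrite x0.
  have := pE 0; rewrite p0 horner0.
  rewrite (sum_tuple_rcons _ (fun w => c w * chain n.+1 (@hstrip F) (0 :: xs) (vac z k.+1) w)).
  have cE v : size v = n.+1 -> chain n.+1 (@hstrip F) (0 :: xs) (vac z k.+1) v
      = chain n.+1 (@hstrip F) xs (vac z k.+1) v.
    move=> sv; rewrite -(sum_tuple_delta (chain n.+1 (@hstrip F) xs _) sv) /=.
    by apply: eq_bigr => v' _; rewrite hstrip0 eq_sym mulrC.
  rewrite sum_bool [X in _ + X]big1 ?addr0 => [E|v _].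
    by rewrite [RHS]E; apply: eq_bigr => v _; rewrite cE ?size_rcons ?size_tuple // vac_rcons chain_rcons1.
  rewrite cE ?size_rcons ?size_tuple //; apply/eqP; apply: contraT.
  case/mulf_neq0_pz => _ /(chain_ends1 _) [|v']; first by rewrite sxs.
  by move/eqP; rewrite eqseq_rcons andbF.
case/lastP: w => // w []; rewrite size_rcons => -[sw]; first exact: c1.
case: z En Hc => [|z] En Hc.
  apply: c0; rewrite -cats1 ones_cat addn0; apply/eqP => E.
  by have := count_size id w; rewrite -/(ones w) E sw -[k]add0n -En ltnn.
move: En; rewrite addSn => -[En].
apply: (IH z k (fun v => c (rcons v false)) En _ _ _ sw) => [v nv | xs sxs xs0].
  by apply: c0; rewrite -cats1 ones_cat addn0.
have := Hc xs sxs xs0.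
rewrite (sum_tuple_rcons _ (fun w => c w * chain n.+1 (@hstrip F) xs (vac z.+1 k) w)).
rewrite sum_bool big1 ?add0r => [|v _]; last by rewrite c1 ?size_tuple ?mul0r.
under eq_bigr => v _ do rewrite (chain_rcons0 sxs En) ?size_tuple // mulrCA.
rewrite -mulr_sumr => /eqP; rewrite mulf_eq0 => /orP[|/eqP //].
by rewrite prodf_seq_eq0 => /hasP[x /(allP xs0) /= /negbTE ->].
Qed.

End Freeness.

Lemma sum_bool2 (R : nmodType) (G : bool * bool -> R) :
  \sum_p G p = G (true, true) + G (true, false) + (G (false, true) + G (false, false)).
Proof.
transitivity (\sum_a \sum_b G (a, b)); first by rewrite pair_bigA; apply: eq_bigr => -[].
by rewrite !sum_bool.
Qed.

Section Pieri.
Variable R : comNzRingType.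
Implicit Types x t : R.

Let vh x t := comp_aut (vstrip_step t) (fun j y z l => hstrip_step x j z y l).
Let hv x t := comp_aut (fun j y z l => hstrip_step x j z y l) (vstrip_step t).

(* Intertwines the two orders of composition of a vertical and a horizontal
   transfer; the defect at the ends of the strings is the factor [1 + t * x]. *)
Let crossing x t (i j : bool * bool) : R :=
  match i, j with
  | (false, false), (false, false) => 1
  | (false, false), (true, true) => x
  | (false, true), (true, false) => 1
  | (true, false), (false, true) => 1 + t * x
  | (true, true), (false, false) => t
  | (true, true), (true, true) => -1
  | _, _ => 0
  end.

Lemma crossing_intertwines x t i a b j :
  \sum_k vh x t i a b k * crossing x t k j
  = \sum_k crossing x t i k * hv x t k a b j.
Proof.
rewrite !sum_bool2 /vh /hv /comp_aut !sum_bool.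
by case: i j a b => [[] []] [[] []] [] []; rewrite /=; ring.
Qed.

(** Commutation of adding a vertical strip and removing a horizontal one. The leading 0 is a free
    column and the trailing 1 a free row, so the box does not interfere. *)
Lemma strips_commute x t n w k :
  size w = n -> size k = n ->
  \sum_(w1 : n.+1.-tuple bool)
     vstrip t (false :: w) w1 * hstrip x (rcons k true) w1
  = (1 + t * x) * \sum_(u : n.+1.-tuple bool)
     hstrip x u (false :: w) * vstrip t u (rcons k true).
Proof.
move=> sw sk.
have s0 : size (false :: w) = n.+1 by rewrite /= sw.
have s1 : size (rcons k true) = n.+1 by rewrite size_rcons sk.
under eq_bigr => w1 _ do rewrite /hstrip aut_swap.
under [in RHS]eq_bigr => u _ do rewrite /hstrip aut_swap.
rewrite (aut_comp (vstrip_step t) (fun i y b j => hstrip_step x i b y j) (false, false) (false, false) s0 s1).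
rewrite (aut_comp (fun i y b j => hstrip_step x i b y j) (vstrip_step t) (false, false) (false, false) s0 s1).
have := aut_intertwine (crossing_intertwines x t) (false, false) (false :: w) (rcons k true) (false, false).
rewrite !sum_bool2 /crossing !mulr0 !mul0r ?mulr1 ?mul1r !add0r !addr0 -/(vh x t) -/(hv x t).
(* The final 1 of the smaller string closes the horizontal strip, so the end state cannot be
   [(true, true)]. *)
have -> : aut (vh x t) (false, false) (false :: w) (rcons k true) (true, true) = 0.
  case/lastP: {s0} (false :: w) => [|w' b]; first by case: (k).
  rewrite aut_rcons big1 // => m _.
  by rewrite /vh /comp_aut sum_bool; case: m b => [[] []] []; rewrite /= ?mulr0 ?addr0 ?mulr0.
(* In front of the leading 0, the state [(true, true)] acts like [(false, false)] up to a factor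
   [t]; with the entry [x] of [crossing] this gives the extra term [t * x]. *)
have -> : aut (hv x t) (true, true) (false :: w) (rcons k true) (false, false)
   = t * aut (hv x t) (false, false) (false :: w) (rcons k true) (false, false).
  case: {s1} (rcons k true) => [|b k']; first by rewrite mulr0.
  rewrite /= mulr_sumr; apply: eq_bigr => m _; rewrite mulrA; congr (_ * _).
  by rewrite /hv /comp_aut !sum_bool; case: m b => [[] []] []; rewrite /=; ring.
by rewrite mul0r add0r => ->; ring.
Qed.

(** The Pieri rule for the generating function of the elementary symmetric polynomials: the vertical
    strip is commuted through the horizontal ones, each of which contributes its factor
    [1 + t * x]. *)
Lemma pieri n xs z k t w : (size xs <= k)%N -> n.+1 = (z.+1 + k)%N -> size w = n ->
  \prod_(x <- xs) (1 + t * x) * chain n.+1 (@hstrip R) xs (vac z.+1 k) (false :: w)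
  = \sum_(w1 : n.+1.-tuple bool)
      vstrip t (false :: w) w1 * chain n.+1 (@hstrip R) xs (vac z.+1 k) w1.
Proof.
move=> + En; elim: xs w => [|x xs IH] w /= lek sw.
  rewrite big_nil mul1r.
  under eq_bigr => w1 _ do rewrite mulrC.
  rewrite (sum_tuple_delta (fun w1 => vstrip t (false :: w) w1)) ?size_vac //.
  by rewrite vstrip_vac /= ?sw // eq_sym.
rewrite big_cons (sum_tupleS _ (fun c => chain n.+1 (@hstrip R) xs (vac z.+1 k) c
   * hstrip x c (false :: w))) sum_bool /=.
rewrite [X in _ * (X + _)]big1 ?add0r; last by move=> c _; rewrite hstrip_cons0 mul0r mulr0.
transitivity ((1 + t * x) * \sum_(u1 : n.+1.-tuple bool)
   chain n.+1 (@hstrip R) xs (vac z.+1 k) u1 *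
   \sum_(u : n.+1.-tuple bool) hstrip x u (false :: w) * vstrip t u u1).
  rewrite -mulrA; congr (_ * _); rewrite mulr_sumr.
  under [RHS]eq_bigr => u1 _ do rewrite mulr_sumr.
  rewrite exchange_big /= (sum_tupleS _ (fun u => \sum_(u1 : n.+1.-tuple bool)
    chain n.+1 (@hstrip R) xs (vac z.+1 k) u1 * (hstrip x u (false :: w) * vstrip t u u1))).
  rewrite sum_bool /= [X in X + _]big1 ?add0r; last first.
    by move=> c _; rewrite big1 // => u1 _; rewrite hstrip_cons0 mul0r mul0r mulr0.
  apply: eq_bigr => u _; rewrite mulrA IH ?size_tuple ?(ltnW lek) // mulr_suml.
  by apply: eq_bigr => u1 _; ring.
rewrite mulr_sumr.
under [RHS]eq_bigr => w1 _ do rewrite mulr_sumr.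
rewrite [RHS]exchange_big /=; apply: eq_bigr => u1 _.
have [->|] := eqVneq (chain n.+1 (@hstrip R) xs (vac z.+1 k) u1) 0.
  by rewrite mul0r mulr0 big1 // => w1 _; ring.
(* Fewer variables than rows remain, so the shape below ends in the 1 that the commutation asks
   for. *)
move/(chain_ends1 lek) => [k' Ek].
have sk' : size k' = n by have := size_tuple u1; rewrite Ek size_rcons => -[].
rewrite mulrCA Ek -strips_commute // mulr_sumr.
by apply: eq_bigr => w1 _; ring.
Qed.

(** Each strip may widen the shape by one column; the leading 0s of [w] pay for this. *)
Lemma pieri_iter n xs ts z k w :
  (size xs <= k)%N -> n = (size ts + z + k)%N -> size w = n ->
  (exists w', w = nseq (size ts) false ++ w') ->
  \prod_(t <- ts) \prod_(x <- xs) (1 + t * x)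
    * chain n (@hstrip R) xs (vac (size ts + z) k) w
  = \sum_(v : n.-tuple bool)
      chain n (@vstrip R) ts w v * chain n (@hstrip R) xs (vac (size ts + z) k) v.
Proof.
move=> lek; elim: ts z => [|t ts IH] z En sw [w' Ew].
  rewrite big_nil mul1r /=.
  by rewrite (sum_tuple_delta (fun v => chain n (@hstrip R) xs _ v)).
rewrite big_cons -mulrA /= [((size ts).+1 + z)%N]addSnnS.
have [w'' Ew'] : exists w'', w = nseq (size ts) false ++ w''.
  by exists (false :: w'); rewrite Ew /= -cat_rcons -nseq_rcons.
rewrite IH //; last 2 first.
- by rewrite addnS -addSn.
- by exists w''.
rewrite mulr_sumr.
under [RHS]eq_bigr => v _ do rewrite mulr_suml.
rewrite exchange_big /=; apply: eq_bigr => c _.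
have [->|] := eqVneq (chain n (@vstrip R) ts w c) 0.
  by rewrite mul0r mulr0 big1 // => v _; rewrite mul0r mul0r.
have -> : w = nseq (size ts + 1) false ++ w' by rewrite Ew addn1.
move/chain_leading => [c' Ec].
case: n {IH} En sw c Ec => [|n] En sw c Ec; first by rewrite addSn in En.
have sc' : size c' = n by have := size_tuple c; rewrite Ec /= => -[].
rewrite mulrCA Ec /= [(size ts + z.+1)%N]addnS.
rewrite (pieri (n := n) t lek En sc').
by rewrite mulr_sumr; apply: eq_bigr => v _; rewrite mulrA.
Qed.

End Pieri.

(** * Puzzles as stacks of rows *)

Lemma sum_label (R : nmodType) (G : label -> R) :
  \sum_l G l = G lab10 + (G lab1 + G lab0).
Proof.
rewrite (bigD1 lab10) //= (bigD1 lab1) //= (bigD1 lab0) //= big1 ?addr0 //.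
by case=> [[]|].
Qed.

Section Puzzles.
Variable R : comNzRingType.
Implicit Types (a b h g l : label) (s t la rmu : seq label).

Definition piece (l1 l2 l3 : label) : R := (allowed l1 l2 l3)%:R.

(* Counts the fillings of a row of triangles with left side [h], right side [b],
   top labels [s] and bottom labels [t]. *)
Fixpoint strip (h : label) (s t : seq label) (b : label) : R :=
  match s, t with
  | [::], [:: z] => piece h b z
  | y :: s', z :: t' =>
      \sum_g \sum_h' piece h g z * piece y h' g * strip h' s' t' b
  | _, _ => 0
  end.

(* The NW labels [la] and the NE labels [rmu] are listed from the bottom up, the
   South labels [t] from left to right. *)
Fixpoint puz (la rmu t : seq label) : R :=
  match la, rmu with
  | [::], [::] => (t == [::])%:R
  | a :: la', b :: rmu' =>
      \sum_(s : (size la').-tuple label) puz la' rmu' s * strip a s t b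
  | _, _ => 0
  end.

(** One up and one down triangle glued along [g]; a row is a sequence of such columns closed by a
    last up triangle. *)
Definition strip_step h y z h' : R := \sum_g piece h g z * piece y h' g.

Lemma strip_rcons_aut h s t z b :
  strip h s (rcons t z) b = \sum_h' aut strip_step h s t h' * piece h' b z.
Proof.
elim: s t h => [|y s IH] [|x t] h /=.
- by rewrite (bigD1 h) //= eqxx mul1r big1 ?addr0 // => h' /negbTE;
    rewrite eq_sym => ->; rewrite mul0r.
- by case: t => [|? t] /=; rewrite big1 // => h' _; rewrite mul0r.
- rewrite big1 ?[RHS]big1 // => [h' _|g _]; first by rewrite mul0r.
  rewrite big1 // => h' _; case: s {IH} => [|? s] /=; last by rewrite mulr0.
  by rewrite mulr0.
rewrite exchange_big /=.
under [RHS]eq_bigr => h' _ do rewrite mulr_suml.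
rewrite [RHS]exchange_big /=; apply: eq_bigr => m _.
under eq_bigr => g _ do rewrite IH.
rewrite -mulr_suml -/(strip_step h y x m) mulr_sumr.
by apply: eq_bigr => h' _; rewrite mulrA.
Qed.

Lemma sum_piece12 (G : label -> label -> R) l3 :
  \sum_u1 \sum_u2 G u1 u2 * piece u1 u2 l3
  = match l3 with
    | Some false => G lab0 lab0 + G lab10 lab1
    | Some true => G lab1 lab1 + G lab0 lab10
    | None => G lab1 lab0
    end.
Proof.
rewrite !sum_label /piece /allowed !inE.
by case: l3 => [[]|] /=; rewrite ?mulr0 ?mulr1 ?add0r ?addr0 ?addr0 // addrC.
Qed.

Lemma sum_piece3 (G : label -> R) l1 l2 :
  \sum_l3 piece l1 l2 l3 * G l3
  = match l1, l2 with
    | Some false, Some false | None, Some true => G lab0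
    | Some true, Some true | Some false, None => G lab1
    | Some true, Some false => G lab10
    | _, _ => 0
    end.
Proof.
rewrite sum_label /piece /allowed !inE.
by case: l1 l2 => [[]|] [[]|] /=; rewrite ?mul0r ?mul1r ?add0r ?addr0.
Qed.

Lemma piece_rot l1 l2 l3 : piece l1 l2 l3 = piece l2 l3 l1.
Proof. by rewrite /piece /allowed !inE; case: l1 l2 l3 => [[]|] [[]|] [[]|]. Qed.

End Puzzles.

Section Lines.
Variable R : comNzRingType.
Variables (tau sig : R).
Hypothesis tau_sig : tau * sig = 1.
Implicit Types (i j m u v : label).

(* Weights for a line, with label [i] before and [j] after, crossing an edge with
   label [u] below the line and [v] above it. They were found by solving the
   relations [slide_up] and [slide_down] together with the condition that the NE
   and South weights restrict to [vstrip_step] on the labels 0 and 1. *)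
Definition nw_step i u v j : R :=
  match i, u, v, j with
  | Some false, Some false, Some false, Some false => - sig
  | Some false, Some true, Some false, Some true => 1
  | Some false, Some true, Some true, Some false => 1
  | Some false, None, Some false, None => 1
  | Some false, None, None, Some false => sig
  | Some true, Some false, Some false, Some true => 1
  | Some true, Some false, Some true, Some false => 1
  | None, Some false, Some false, None => 1
  | None, Some false, None, Some false => sig
  | None, Some true, Some true, None => 1
  | _, _, _, _ => 0
  end.

Definition ne_step i u v j : R :=
  match i, u, v, j with
  | Some false, Some false, Some true, None => tau
  | Some false, Some true, Some true, Some false => tau
  | Some false, None, Some true, Some true => tau
  | Some true, Some false, None, None => tau
  | Some true, Some true, Some true, Some true => 1
  | Some true, Some true, None, Some false => tau
  | Some true, None, None, Some true => tau
  | None, Some false, Some false, None => 1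
  | None, Some true, Some false, Some false => 1
  | None, Some true, Some true, None => 1
  | None, None, Some false, Some true => 1
  | None, None, None, None => 1
  | _, _, _, _ => 0
  end.

Definition south_step i u v j : R :=
  match i, u, v, j with
  | Some false, Some false, Some false, Some false => 1
  | Some false, Some true, Some true, Some false => tau
  | Some false, None, Some true, None => tau
  | Some true, Some false, Some true, None => tau
  | Some true, Some true, Some true, Some true => tau
  | None, Some false, Some false, None => 1
  | None, Some true, Some false, Some true => 1
  | None, Some true, Some true, None => 1
  | None, Some true, None, Some false => 1
  | None, None, None, None => 1
  | _, _, _, _ => 0
  end.

Let simpls := (mul0r, mulr0, add0r, addr0, mul1r, mulr1, tau_sig, mulNr, mulrN).

(** The line runs above the triangle on the left of the equation and below it on the right. This is
    a finite check; the cancellations come from the entry [- sig] of [nw_step]. *)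
Lemma slide_up i v1 v2 l3 j :
  \sum_u1 \sum_u2 \sum_m
     nw_step i u1 v1 m * ne_step m u2 v2 j * piece R u1 u2 l3
  = \sum_v3 piece R v1 v2 v3 * south_step i l3 v3 j.
Proof.
under eq_bigr => u1 _ do under eq_bigr => u2 _ do rewrite -mulr_suml.
rewrite sum_piece12 sum_piece3.
have st : sig * tau = 1 by rewrite mulrC.
case: i j => [[]|] [[]|]; case: v1 v2 l3 => [[]|] [[]|] [[]|];
by rewrite ?sum_label /= ?simpls ?st ?subrr ?addNr.
Qed.

Lemma slide_down i vt ur ul j :
  \sum_g south_step i g vt j * piece R g ur ul
  = \sum_m \sum_vl \sum_vr
     ne_step i ul vl m * nw_step m ur vr j * piece R vt vr vl.
Proof.
under eq_bigr => g _ do rewrite piece_rot mulrC.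
rewrite exchange_big /=.
under [RHS]eq_bigr => vl _ do rewrite exchange_big /=.
rewrite exchange_big /=.
under [RHS]eq_bigr => vr _ do under eq_bigr => vl _ do rewrite -mulr_suml piece_rot.
rewrite sum_piece12 sum_piece3.
have st : sig * tau = 1 by rewrite mulrC.
case: i j => [[]|] [[]|]; case: vt ur ul => [[]|] [[]|] [[]|];
by rewrite ?sum_label /= ?simpls ?st ?subrr ?addNr.
Qed.

End Lines.

(** * Sliding a line through a puzzle *)

Lemma sum_pair (R : nmodType) (I J : finType) (G : I * J -> R) :
  \sum_p G p = \sum_a \sum_b G (a, b).
Proof. by rewrite pair_bigA; apply: eq_bigr => -[]. Qed.

Section Lines.
Variable R : comNzRingType.
Variables (tau sig : R).
Hypothesis tau_sig : tau * sig = 1.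
Implicit Types (j b : label).
Local Notation W := (nw_step sig).
Local Notation E := (ne_step tau).
Local Notation S := (south_step tau).
Local Notation piece := (piece R).
Local Notation strip_step := (strip_step R).

(** A row with the line running over it, or under it. [cross] is the line crossing a slanted edge of
    the row; it exchanges the two components of the state. *)
Let above := comp_aut (fun m y0 y m' => S m y y0 m') strip_step.
Let below := comp_aut strip_step (fun m z1 z m' => S m z z1 m').
Let cross (k : label * label) (k' : label * label) : R := W k.2 k'.2 k.1 k'.1.

(** [slide_up] for the up triangle of the column, then [slide_down] for its down triangle; the rest
    is reordering of sums. *)
Lemma slide_step k y0 z k' :
  \sum_p below k y0 z p * cross p k' = \sum_p cross k p * above p y0 z k'.
Proof.
case: k k' => a i [m' h']; rewrite !sum_pair /below /above /cross /comp_aut /=.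
pose T m1 vl vr v3 := piece a vl v3 * S i z v3 m1 * W m1 h' vr m' * piece y0 vr vl.
transitivity (\sum_m1 \sum_vl \sum_vr \sum_v3 T m1 vl vr v3).
  rewrite exchange_big /=; apply: eq_bigr => m1 _.
  under eq_bigr => vr _ do rewrite mulr_suml.
  under eq_bigr => vr _.
    under eq_bigr => v3 _ do rewrite /strip_step !mulr_suml.
    over.
  under eq_bigr => vr _ do rewrite exchange_big /=.
  rewrite exchange_big /=; apply: eq_bigr => vl _; apply: eq_bigr => vr _.
  by apply: eq_bigr => v3 _; rewrite /T; ring.
transitivity (\sum_m1 \sum_vl \sum_vr \sum_g \sum_a' \sum_m
   (W i a' a m * E m g vl m1 * piece a' g z) * (W m1 h' vr m' * piece y0 vr vl)).
  apply: eq_bigr => m1 _; apply: eq_bigr => vl _; apply: eq_bigr => vr _.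
  transitivity ((\sum_v3 piece a vl v3 * S i z v3 m1) * (W m1 h' vr m' * piece y0 vr vl)).
    by rewrite mulr_suml; apply: eq_bigr => v3 _; rewrite /T; ring.
  rewrite -(slide_up tau_sig). rewrite exchange_big mulr_suml; apply: eq_bigr => g _.
  by rewrite mulr_suml; apply: eq_bigr => a' _; rewrite mulr_suml.
under [LHS]eq_bigr => m1 _.
  under eq_bigr => vl _ do rewrite exchange_big /=.
  rewrite exchange_big /=.
  over.
rewrite [LHS]exchange_big /=.
under [RHS]eq_bigr => m _.
  under eq_bigr => a' _.
    rewrite mulr_sumr.
    under eq_bigr => y _ do rewrite /strip_step mulr_sumr mulr_sumr.
    rewrite exchange_big /=.
    over.
  rewrite exchange_big /=.
  over.
rewrite [RHS]exchange_big /=; apply: eq_bigr => g _.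
transitivity (\sum_m \sum_a' \sum_m1 \sum_vl \sum_vr
   (W i a' a m * E m g vl m1 * piece a' g z) * (W m1 h' vr m' * piece y0 vr vl)).
  under [LHS]eq_bigr => m1 _.
    under eq_bigr => vl _.
      under eq_bigr => vr _ do rewrite exchange_big /=.
      rewrite exchange_big /=.
      under eq_bigr => m _ do rewrite exchange_big /=.
      over.
    rewrite exchange_big /=.
    under eq_bigr => m _ do rewrite exchange_big /=.
    over.
  rewrite exchange_big /=; apply: eq_bigr => m _.
  by rewrite exchange_big.
apply: eq_bigr => m _; apply: eq_bigr => a' _.
have := slide_down tau_sig m y0 h' g m' => H.
transitivity (W i a' a m * piece a' g z * \sum_y S m y y0 m' * piece y h' g).
  rewrite H mulr_sumr; apply: eq_bigr => m1 _.
  rewrite mulr_sumr; apply: eq_bigr => vl _.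
  by rewrite mulr_sumr; apply: eq_bigr => vr _; ring.
by rewrite mulr_sumr; apply: eq_bigr => y _; ring.
Qed.

(* On the NW side the line keeps the label 10 and does not see the labels 0, 1. *)
Lemma cross_frozen (c : bool) (G : label * label -> R) :
  \sum_p cross (Some c, lab10) p * G p = G (lab10, Some c).
Proof.
rewrite sum_pair !sum_label /cross /=.
by case: c; rewrite /= !(mul0r, mul1r, add0r, addr0).
Qed.

(** The train argument along a row. At the left end the line is frozen; at the right end [slide_up]
    for the last triangle trades the crossing of a South edge for that of a NE edge. *)
Lemma slide_strip (c : bool) n s t b j : size s = n -> size t = n.+1 ->
  \sum_(s' : n.-tuple label) \sum_b' \sum_j1
     aut S lab10 s' s j1 * strip R (Some c) s' t b' * E j1 b' b j
  = \sum_(t' : n.+1.-tuple label) strip R (Some c) s t' b * aut S lab10 t t' j.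
Proof.
move=> ss; case/lastP: t => // t z; rewrite size_rcons => -[st].
pose G u1 m2 := \sum_u2 E m2 u2 b j * piece u1 u2 z.
transitivity (\sum_u1 \sum_m2 aut above (lab10, Some c) s t (m2, u1) * G u1 m2).
  under [RHS]eq_bigr => u1 _ do under eq_bigr => m2 _ do
    rewrite -(aut_comp _ _ (lab10, Some c) (m2, u1) ss st) mulr_suml.
  under [RHS]eq_bigr => u1 _ do rewrite exchange_big /=.
  rewrite [RHS]exchange_big /=; apply: eq_bigr => s' _.
  under eq_bigr => b' _ do under eq_bigr => j1 _ do
    rewrite strip_rcons_aut mulr_sumr mulr_suml.
  under eq_bigr => b' _ do rewrite exchange_big /=.
  rewrite exchange_big /=; apply: eq_bigr => u1 _.
  rewrite exchange_big /=; apply: eq_bigr => m2 _.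
  rewrite /G mulr_sumr; apply: eq_bigr => b' _.
  by rewrite aut_swap; ring.
under [LHS]eq_bigr => u1 _ do under eq_bigr => m2 _ do
  rewrite -(cross_frozen c (fun p => aut above p s t (m2, u1)))
    -(aut_intertwine slide_step) sum_pair mulr_suml.
rewrite (sum_tuple_rcons _ (fun t' => strip R (Some c) s t' b * aut S lab10 (rcons t z) t' j)).
transitivity (\sum_h \sum_m aut below (Some c, lab10) s t (h, m) *
   \sum_v3 piece h b v3 * S m z v3 j).
  under [RHS]eq_bigr => h _ do under eq_bigr => m _ do rewrite -(slide_up tau_sig) mulr_sumr.
  under [LHS]eq_bigr => u1 _ do rewrite exchange_big /=.
  rewrite [LHS]exchange_big /=; apply: eq_bigr => h _.
  rewrite [RHS]exchange_big /=; apply: eq_bigr => u1 _.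
  under [LHS]eq_bigr => m2 _ do rewrite mulr_suml.
  rewrite [LHS]exchange_big /=; apply: eq_bigr => m _.
  rewrite mulr_sumr.
  under [RHS]eq_bigr => u2 _ do rewrite mulr_sumr.
  rewrite [RHS]exchange_big /=; apply: eq_bigr => m2 _.
  rewrite /G mulr_sumr; apply: eq_bigr => u2 _.
  by rewrite /cross /=; ring.
under [LHS]eq_bigr => h _ do under eq_bigr => m _ do rewrite mulr_sumr.
under [LHS]eq_bigr => h _ do rewrite exchange_big /=.
rewrite [LHS]exchange_big /=; apply: eq_bigr => v3 _.
under [LHS]eq_bigr => h _ do under eq_bigr => m _ do
  rewrite -(aut_comp _ _ (Some c, lab10) (h, m) ss st) mulr_suml.
under [LHS]eq_bigr => h _ do rewrite exchange_big /=.
rewrite [LHS]exchange_big /=; apply: eq_bigr => t' _.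
rewrite strip_rcons_aut aut_rcons mulr_suml; apply: eq_bigr => h _.
rewrite mulr_sumr; apply: eq_bigr => m _.
by rewrite [aut S _ _ _ _]aut_swap; ring.
Qed.

(** The line under the puzzle is lifted over one row at a time. Each row leaves one crossing on the
    NE side, until the line lies entirely along that side. *)
Lemma slide_puz (l : seq bool) (rmu t : seq label) j :
  size rmu = size l -> size t = size l ->
  \sum_(r : (size l).-tuple label)
     puz R (map Some l) r t * aut E lab10 (rev r) (rev rmu) j
  = \sum_(s : (size l).-tuple label)
     puz R (map Some l) rmu s * aut S lab10 t s j.
Proof.
elim: l rmu t j => [|a l IH] [|b rmu] t j //.
  move=> _; case: t => // _.
  rewrite (sum_tuple0 (fun r => puz R [::] r [::] * aut E lab10 (rev r) (rev [::]) j)).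
  by rewrite (sum_tuple0 (fun s => puz R [::] [::] s * aut S lab10 [::] s j)).
move=> [srmu] st.
rewrite (sum_tupleS _ (fun r => puz R (map Some (a :: l)) r t * aut E lab10 (rev r) (rev (b :: rmu)) j)).
rewrite map_cons /= size_map.
transitivity (\sum_(s : (size l).-tuple label) puz R (map Some l) rmu s *
   \sum_(t' : (size l).+1.-tuple label) strip R (Some a) s t' b * aut S lab10 t t' j); last first.
  under [LHS]eq_bigr => s _ do rewrite mulr_sumr.
  rewrite [LHS]exchange_big /=; apply: eq_bigr => t' _; rewrite mulr_suml.
  by apply: eq_bigr => s _; rewrite mulrA.
under [RHS]eq_bigr => s _.
  rewrite -slide_strip ?size_tuple // mulr_sumr.
  under eq_bigr => s' _ do rewrite mulr_sumr.
  under eq_bigr => s' _ do under eq_bigr => b' _ do rewrite mulr_sumr.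
  over.
rewrite [RHS]exchange_big /=.
under [RHS]eq_bigr => s' _ do rewrite exchange_big /=.
rewrite [RHS]exchange_big /=; apply: eq_bigr => b' _.
under [LHS]eq_bigr => r _ do rewrite mulr_suml.
rewrite [LHS]exchange_big /=; apply: eq_bigr => s' _.
rewrite [RHS]exchange_big /=.
transitivity (\sum_j1 (\sum_(r : (size l).-tuple label)
    puz R (map Some l) r s' * aut E lab10 (rev r) (rev rmu) j1)
    * (strip R (Some a) s' t b' * E j1 b' b j)).
  under [RHS]eq_bigr => j1 _ do rewrite mulr_suml.
  rewrite [RHS]exchange_big /=; apply: eq_bigr => r _.
  rewrite !rev_cons aut_rcons mulr_sumr; apply: eq_bigr => j1 _; ring.
apply: eq_bigr => j1 _; rewrite IH ?size_tuple // mulr_suml.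
by apply: eq_bigr => s _; ring.
Qed.

Lemma south_vstrip n (u : seq bool) (G : seq label -> R) : size u = n ->
  \sum_(v : n.-tuple label) G v * aut S lab10 (map Some u) v lab10
  = \sum_(v : n.-tuple bool) G (map Some v) * vstrip tau v u.
Proof.
pose st (i : bool) : label := if i then lab1 else lab10.
suff H i : \sum_(v : (size u).-tuple label) G v * aut S (st i) (map Some u) v lab10
    = \sum_(v : (size u).-tuple bool) G (map Some v) * aut (vstrip_step tau) i v u false.
  by move=> <-; apply: (H false).
(* A line with label 0 cannot come back to 10. This discards the words containing a label 10 and
   leaves 1 and 10 as the two states of [vstrip_step]. *)
have dead (w : seq label) (u' : seq bool) : aut S lab0 (map Some u') w lab10 = 0.
  elim: u' w => [|a u' IH] [|y w] //=; rewrite sum_label.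
  by case: a y => [] [[]|]; rewrite /= !(mul0r, add0r, addr0, IH, mulr0).
elim: u i G => [|a u IH] i G.
  rewrite (sum_tuple0 (fun v => G v * aut S (st i) (map Some [::]) v lab10)).
  rewrite (sum_tuple0 (fun v => G (map Some v) * aut (vstrip_step tau) i v [::] false)).
  by case: i.
rewrite (sum_tupleS _ (fun v => G v * aut S (st i) (map Some (a :: u)) v lab10)).
rewrite (sum_tupleS _ (fun v => G (map Some v) * aut (vstrip_step tau) i v (a :: u) false)).
rewrite sum_label sum_bool.
have L y : \sum_(w : (size u).-tuple label) G (y :: w) * aut S (st i) (map Some (a :: u)) (y :: w) lab10
   = \sum_i' S (st i) (Some a) y (st i') *
      \sum_(w : (size u).-tuple bool) G (y :: map Some w) * aut (vstrip_step tau) i' w u false.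
  under [RHS]eq_bigr => i' _ do rewrite -(IH i' (fun w => G (y :: w))) mulr_sumr.
  rewrite [RHS]exchange_big /=; apply: eq_bigr => w _.
  by rewrite sum_bool sum_label dead mulr0 addr0 /=; ring.
have L' (y : bool) : \sum_(w : (size u).-tuple bool) G (map Some (y :: w)) * aut (vstrip_step tau) i (y :: w) (a :: u) false
   = \sum_i' vstrip_step tau i y a i' *
      \sum_(w : (size u).-tuple bool) G (Some y :: map Some w) * aut (vstrip_step tau) i' w u false.
  under [RHS]eq_bigr => i' _ do rewrite mulr_sumr.
  rewrite [RHS]exchange_big /=; apply: eq_bigr => w _.
  by rewrite mulr_sumr; apply: eq_bigr => i' _; ring.
rewrite !L !L' !sum_bool.
by case: i a {IH L L'} => [] []; rewrite /vstrip_step /= !(mul0r, add0r, addr0).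
Qed.

Lemma ne_vstrip n (v : seq bool) (G : seq label -> R) : size v = n ->
  \sum_(u : n.-tuple label) G u * aut E lab10 u (map Some v) lab10
  = \sum_(u : n.-tuple bool) G (map Some u) * vstrip tau v u.
Proof.
pose st (i : bool) : label := if i then lab0 else lab10.
suff H i : \sum_(u : (size v).-tuple label) G u * aut E (st i) u (map Some v) lab10
    = \sum_(u : (size v).-tuple bool) G (map Some u) * aut (vstrip_step tau) i v u false.
  by move=> <-; apply: (H false).
(* On this side it is label 1 that cannot come back to 10, and the two states are 0 and 10. *)
have dead (w : seq label) (v' : seq bool) : aut E lab1 w (map Some v') lab10 = 0.
  elim: v' w => [|a v' IH] [|y w] //=; rewrite sum_label.
  by case: a y => [] [[]|]; rewrite /= !(mul0r, add0r, addr0, IH, mulr0).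
elim: v i G => [|a v IH] i G.
  rewrite (sum_tuple0 (fun u => G u * aut E (st i) u (map Some [::]) lab10)).
  rewrite (sum_tuple0 (fun u => G (map Some u) * aut (vstrip_step tau) i [::] u false)).
  by case: i.
rewrite (sum_tupleS _ (fun u => G u * aut E (st i) u (map Some (a :: v)) lab10)).
rewrite (sum_tupleS _ (fun u => G (map Some u) * aut (vstrip_step tau) i (a :: v) u false)).
rewrite sum_label sum_bool.
have L y : \sum_(w : (size v).-tuple label) G (y :: w) * aut E (st i) (y :: w) (map Some (a :: v)) lab10
   = \sum_i' E (st i) y (Some a) (st i') *
      \sum_(w : (size v).-tuple bool) G (y :: map Some w) * aut (vstrip_step tau) i' v w false.
  under [RHS]eq_bigr => i' _ do rewrite -(IH i' (fun w => G (y :: w))) mulr_sumr.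
  rewrite [RHS]exchange_big /=; apply: eq_bigr => w _.
  by rewrite sum_bool sum_label dead mulr0 add0r /=; ring.
have L' (y : bool) : \sum_(w : (size v).-tuple bool) G (map Some (y :: w)) * aut (vstrip_step tau) i (a :: v) (y :: w) false
   = \sum_i' vstrip_step tau i a y i' *
      \sum_(w : (size v).-tuple bool) G (Some y :: map Some w) * aut (vstrip_step tau) i' v w false.
  under [RHS]eq_bigr => i' _ do rewrite mulr_sumr.
  rewrite [RHS]exchange_big /=; apply: eq_bigr => w _.
  by rewrite mulr_sumr; apply: eq_bigr => i' _; ring.
rewrite !L !L' !sum_bool.
by case: i a {IH L L'} => [] []; rewrite /vstrip_step /= !(mul0r, add0r, addr0).
Qed.

End Lines.

(* The South side [nu] is read from left to right, against the clockwise order. *)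
Definition tripuz (R : comNzRingType) (la mu nu : seq bool) : R :=
  puz R (map Some la) (map Some (rev mu)) (map Some nu).

(** [sig] occurs only in the NW weights at intermediate positions of the line and disappears from
    the result; only the invertibility of [tau] remains. *)
Lemma tripuz_vstrip (R : comNzRingType) (tau sig : R) n (la mu nu : seq bool) :
  tau * sig = 1 -> size la = n -> size mu = n -> size nu = n ->
  \sum_(k : n.-tuple bool) vstrip tau mu k * tripuz R la k nu
  = \sum_(k : n.-tuple bool) vstrip tau k nu * tripuz R la mu k.
Proof.
move=> ts sl sm sn.
have smr : size (map Some (rev mu)) = size la by rewrite size_map size_rev sm.
have snr : size (map Some nu) = size la by rewrite size_map sn.
have := slide_puz ts lab10 smr snr; rewrite sl.
rewrite south_vstrip // map_rev revK.
rewrite (sum_tuple_rev _ (fun r => puz R (map Some la) r (map Some nu) *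
   aut (ne_step tau) lab10 (rev r) (map Some mu) lab10)).
under [LHS]eq_bigr => r _ do rewrite revK.
rewrite (ne_vstrip tau (fun r => puz R (map Some la) (rev r) (map Some nu)) sm) => H.
under [LHS]eq_bigr => k _ do rewrite mulrC /tripuz map_rev.
by rewrite H; apply: eq_bigr => k _; rewrite mulrC /tripuz map_rev.
Qed.

(** * Puzzles with a trivial side, and reflection *)

Section Unit.
Variable R : comNzRingType.

(* The South labels of the only puzzle with NW side [l] and NE side
   [0^(size l - j) 1^j]; see [puz_unit]. *)
Fixpoint unit_row (l : seq bool) (j : nat) : seq label :=
  if l is a :: l' then
    (if a then (if (ones l' < j)%N then lab1 else lab10) else lab0) :: unit_row l' j
  else [::].

Lemma size_unit_row l j : size (unit_row l j) = size l.
Proof. by elim: l => //= a l ->. Qed.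

Lemma unit_row_ones l j : (ones l <= j)%N -> unit_row l j = map Some l.
Proof.
elim: l => [|[] l IH] //=; rewrite /ones /= => H; last by rewrite IH.
by rewrite -/(ones l) H IH // ltnW.
Qed.

Local Notation strip := (strip R).
Local Notation piece := (piece R).

Lemma strip_cons h y s z t b :
  strip h (y :: s) (z :: t) b
  = \sum_g \sum_h' piece h g z * piece y h' g * strip h' s t b.
Proof. by []. Qed.

(** The left label varies from column to column, so the induction carries all three values, 10
    included. *)
Lemma strip_unit0 l t :
  strip lab10 (unit_row l 0) t lab0 = 0 /\
  forall a : bool, strip (Some a) (unit_row l 0) t lab0 = (t == unit_row (a :: l) 0)%:R.
Proof.
elim: l t => [|c l IH] t.
  case: t => [|z [|z' t]] //=; split=> [|a]; rewrite ?eqseq_cons ?andbF //.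
  by rewrite /piece /allowed !inE; case: a z => [] [[]|].
case: t => [|z t]; first by split.
have [IH0 IH1] := IH t.
split=> [|a]; rewrite [unit_row _ _ in LHS]/= ?ltn0 strip_cons !sum_label /piece /allowed !inE.
  by case: c z => [] [[]|]; rewrite /= ?IH0 ?(mul0r, mulr0, addr0).
by case: a c z => [] [] [[]|]; rewrite /= ?IH0 ?IH1 ?(mul0r, mulr0, addr0, add0r, mul1r).
Qed.

Lemma strip_unit1 l j t :
  [/\ strip lab1 (unit_row l j) t lab1 = (t == unit_row (true :: l) j.+1)%:R,
      strip lab0 (unit_row l j) t lab1
        = ((j < ones l)%N && (t == unit_row (false :: l) j.+1))%:R
    & strip lab10 (unit_row l j) t lab1
        = ((ones l <= j)%N && (t == lab0 :: unit_row l j))%:R].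
Proof.
elim: l t => [|c l IH] t.
  case: t => [|z [|z' t]] //=; split; rewrite ?eqseq_cons ?andbF //;
    by rewrite /piece /allowed !inE; case: z => [[]|].
case: t => [|z t]; first by split; rewrite /= ?andbF.
have [IH1 IH0 IHt] := IH t.
have o0 : ones (false :: l) = ones l by [].
have o1 : ones (true :: l) = (ones l).+1 by [].
have uE : (ones l <= j)%N -> unit_row l j = unit_row l j.+1.
  by move=> H; rewrite !unit_row_ones // leqW.
split; rewrite [unit_row _ _ in LHS]/= strip_cons !sum_label /piece /allowed !inE
  ![unit_row (_ :: _) _]/= eqseq_cons ?o0 ?o1;
  case: c z => [] [[]|]; rewrite /= ?IH1 ?IH0 ?IHt ?[unit_row (_ :: _) _]/= ?ltnS;
  case: (ltngtP (ones l) j) => H; rewrite /= ?IH1 ?IH0 ?IHt ?ltnn ?leqnn ?andbF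
    ?(mul0r, mulr0, addr0, add0r, mul1r) //= ?uE ?(ltnW H) ?H //.
Qed.

(** Every row is forced by the one above. Each 1 on the NE side allows one more 1, counted from the
    right, on the South side; after [ones l] of them no label 10 is left. *)
Lemma puz_unit l j t : (j <= ones l)%N ->
  puz R (map Some l) (map Some (nseq j true ++ nseq (size l - j) false)) t
  = (t == unit_row l j)%:R.
Proof.
elim: l j t => [|a l IH] j t.
  by case: j.
have IH' m (F : seq label -> R) : (m <= ones l)%N ->
   \sum_(s : (size (map Some l)).-tuple label)
     puz R (map Some l) (map Some (nseq m true ++ nseq (size l - m) false)) s * F s
   = F (unit_row l m).
  move=> H; rewrite -(sum_tuple_delta F (n := size (map (@Some bool) l)) (u := unit_row l m)).
    by apply: eq_bigr => s _; rewrite IH // eq_sym.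
  by rewrite size_unit_row size_map.
case: j => [|j] lej; rewrite map_cons /=.
  have := IH' 0%N (fun s => strip (Some a) s t lab0) (leq0n _).
  by rewrite /= subn0 => ->; rewrite (strip_unit0 l t).2.
have lj : (j <= ones l)%N by move: lej; rewrite /ones /=; case: (a) => //= /ltnW.
have := IH' j (fun s => strip (Some a) s t lab1) lj.
rewrite /= subSS => ->; have [H1 H0 _] := strip_unit1 l j t.
by case: a lej => lej; rewrite ?H1 // H0 (lej : (j < ones l)%N).
Qed.

Lemma tripuz_unit n z k (la nu : seq bool) :
  n = (z + k)%N -> size la = n -> ones la = k ->
  tripuz R la (vac z k) nu = (nu == la)%:R.
Proof.
move=> En sl ol; rewrite /tripuz rev_cat !rev_nseq.
have -> : z = (size la - k)%N by rewrite sl En addnK.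
rewrite puz_unit ?ol // unit_row_ones ?ol // inj_eq //.
by apply: inj_map => x y [].
Qed.

Definition flip (l : label) : label := omap negb l.

Lemma flipK : involutive flip.
Proof. by case=> [[]|]. Qed.

(** A reflection reverses the clockwise order; exchanging 0 and 1 restores the allowed pieces. *)
Lemma piece_flip l1 l2 l3 : piece (flip l2) (flip l1) (flip l3) = piece l1 l2 l3.
Proof. by rewrite /piece /allowed !inE; case: l1 l2 l3 => [[]|] [[]|] [[]|]. Qed.

Lemma sum_flip (F : label -> R) : \sum_l F l = \sum_l F (flip l).
Proof. exact: reindex_inj (inv_inj flipK). Qed.

Lemma strip_rcons h s t y z b : size t = (size s).+1 ->
  strip h (rcons s y) (rcons t z) b
  = \sum_g \sum_h' strip h s t g * piece y h' g * piece h' b z.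
Proof.
elim: s t h => [|x s IH] [|c t] h // [st].
  by case: t st.
rewrite !rcons_cons strip_cons.
under eq_bigr => g _ do under eq_bigr => h' _ do rewrite IH // mulr_sumr.
under eq_bigr => g _ do rewrite exchange_big /=.
rewrite exchange_big /=; apply: eq_bigr => g' _.
under eq_bigr => g _ do under eq_bigr => h' _ do rewrite mulr_sumr.
under eq_bigr => g _ do rewrite exchange_big /=.
rewrite exchange_big /=; apply: eq_bigr => h1 _.
rewrite !mulr_suml; apply: eq_bigr => g _.
by rewrite !mulr_suml; apply: eq_bigr => h' _; ring.
Qed.

Lemma strip_flip h s t b : size t = (size s).+1 ->
  strip (flip b) (rev (map flip s)) (rev (map flip t)) (flip h) = strip h s t b.
Proof.
elim: s t h => [|y s IH] [|z t] h // [st].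
  by case: t st => //= _; rewrite piece_flip.
rewrite !map_cons !rev_cons strip_rcons; last by rewrite !size_rev !size_map.
rewrite strip_cons [RHS]exchange_big /= sum_flip; apply: eq_bigr => h' _.
rewrite sum_flip; apply: eq_bigr => g _.
by rewrite IH // !piece_flip (piece_rot _ g); ring.
Qed.

Lemma puz_flip la rmu t : size rmu = size la -> size t = size la ->
  puz R (map flip rmu) (map flip la) (rev (map flip t)) = puz R la rmu t.
Proof.
elim: la rmu t => [|a la IH] [|b rmu] t //=; first by case: t.
move=> [srt] st; rewrite size_map srt.
rewrite (sum_tuple_rev _ (fun s => puz R (map flip rmu) (map flip la) s *
  strip (flip b) s (rev (map flip t)) (flip a))).
rewrite (sum_tuple_map _ (fun s => puz R (map flip rmu) (map flip la) (rev s) *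
  strip (flip b) (rev s) (rev (map flip t)) (flip a)) flipK).
by apply: eq_bigr => s _; rewrite IH ?size_tuple // strip_flip // size_tuple.
Qed.

Lemma tripuz_star (la mu nu : seq bool) : size mu = size la -> size nu = size la ->
  tripuz R (star mu) (star la) (star nu) = tripuz R la mu nu.
Proof.
move=> sm sn; rewrite -[RHS]puz_flip ?size_map ?size_rev ?sm // /tripuz.
by rewrite /star !map_rev !revK -!map_comp.
Qed.

End Unit.

Lemma vchain_tripuz (R : comNzRingType) n (ts : seq R) (la mu nu : seq bool) :
  (forall t, t \in ts -> exists t', t * t' = 1) ->
  size la = n -> size mu = n -> size nu = n ->
  \sum_(k : n.-tuple bool) chain n (@vstrip R) ts mu k * tripuz R la k nu
  = \sum_(k : n.-tuple bool) chain n (@vstrip R) ts k nu * tripuz R la mu k.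
Proof.
move=> + sl sm; elim: ts nu => [|t ts IH] nu inv sn /=.
  rewrite (sum_tuple_delta (fun k => tripuz R la k nu)) //.
  under eq_bigr => k _ do rewrite eq_sym.
  by rewrite (sum_tuple_delta (fun k => tripuz R la mu k)).
have [t' tt'] := inv t (mem_head _ _).
have inv' x : x \in ts -> exists x', x * x' = 1 by move=> xs; apply: inv; rewrite inE xs orbT.
under eq_bigr => k _ do rewrite mulr_suml.
rewrite exchange_big /=.
transitivity (\sum_(c : n.-tuple bool) chain n (@vstrip R) ts mu c *
    \sum_(k : n.-tuple bool) vstrip t c k * tripuz R la k nu).
  by apply: eq_bigr => c _; rewrite mulr_sumr; apply: eq_bigr => k _; rewrite mulrA.
under [LHS]eq_bigr => c _ do rewrite (tripuz_vstrip tt' sl (size_tuple c) sn) mulr_sumr.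
rewrite exchange_big /=.
under [RHS]eq_bigr => k _ do rewrite mulr_suml.
rewrite [RHS]exchange_big /=; apply: eq_bigr => d _.
transitivity (vstrip t d nu * \sum_(c : n.-tuple bool) chain n (@vstrip R) ts mu c * tripuz R la c d).
  by rewrite mulr_sumr; apply: eq_bigr => c _; ring.
rewrite IH ?size_tuple // mulr_sumr; apply: eq_bigr => c _; ring.
Qed.

(** The expansion of a skew Schur function with puzzle numbers as coefficients: it is
    [vchain_tripuz] with the empty partition on the NE side. *)
Lemma vchain_expand (R : comNzRingType) n z k (ts : seq R) (la nu : seq bool) :
  (forall t, t \in ts -> exists t', t * t' = 1) ->
  n = (z + k)%N -> size la = n -> size nu = n -> ones la = k ->
  chain n (@vstrip R) ts la nu
  = \sum_(m : n.-tuple bool) tripuz R la m nu * chain n (@vstrip R) ts (vac z k) m.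
Proof.
move=> inv En sl sn ol.
under eq_bigr => m _ do rewrite mulrC.
rewrite vchain_tripuz ?size_vac //.
under eq_bigr => m _ do rewrite (tripuz_unit _ _ En sl ol) mulrC eq_sym.
by rewrite (sum_tuple_delta (fun m => chain n (@vstrip R) ts m nu)).
Qed.

(** * Puzzles and products *)

Section Products.
Variable F : fieldType.
Hypothesis F_char0 : forall n, n.+1%:R != 0 :> F.

(** Strings with another number of 1s contribute nothing to the sums, so [c] may be replaced by 0 on
    them. *)
Lemma hchain_free n z k (c : seq bool -> F) : n = (z + k)%N ->
  (forall xs, size xs = k -> all (predC1 0) xs ->
     \sum_(w : n.-tuple bool) c w * chain n (@hstrip F) xs (vac z k) w = 0) ->
  forall w, size w = n -> ones w = k -> c w = 0.
Proof.
move=> En Hc w sw ow; pose c' w := if ones w == k then c w else 0.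
have := @chain_free F F_char0 n z k c' En _ _ w sw.
rewrite /c' ow eqxx; apply=> [v /negbTE -> //|xs sxs xs0].
rewrite -[RHS](Hc xs sxs xs0); apply: eq_bigr => v _; case: eqP => // nv.
have [->|/chain_ones] := eqVneq (chain n (@hstrip F) xs (vac z k) v) 0.
  by rewrite !mulr0.
by rewrite ones_vac => Ek; rewrite -Ek in nv.
Qed.

Lemma vchain_free n z k (c : seq bool -> F) : n = (z + k)%N ->
  (forall ts, size ts = z -> all (predC1 0) ts ->
     \sum_(w : n.-tuple bool) c w * chain n (@vstrip F) ts (vac z k) w = 0) ->
  forall w, size w = n -> ones w = k -> c w = 0.
Proof.
move=> En Hc w sw ow; rewrite -[w]starK.
apply: (@hchain_free n k z (c \o star)); rewrite ?size_star ?ones_star.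
- by rewrite addnC.
- move=> ts sts ts0; rewrite -[RHS](Hc ts sts ts0).
  rewrite [RHS](sum_star _ (fun w => c w * chain n (@vstrip F) ts (vac z k) w)).
  by apply: eq_bigr => v _; rewrite chain_star starK star_vac.
- by [].
- by have := ones_zeros w; rewrite ow sw En addnC => /addIn.
Qed.

(** The [z] strips use at most [z] of the [z + z] leading 0s, so every string that is reached keeps
    [z] of them. *)
Lemma vchain_pad n z k (ts : seq F) (G : seq bool -> F) : size ts = z ->
  \sum_(w : (z + n).-tuple bool) G w * chain (z + n) (@vstrip F) ts (vac (z + z) k) w
  = \sum_(w : n.-tuple bool)
      G (nseq z false ++ w) * chain n (@vstrip F) ts (vac z k) w.
Proof.
move=> sts.
rewrite (sum_tuple_cat z n (fun w => G w * chain (z + n) (@vstrip F) ts (vac (z + z) k) w)).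
rewrite exchange_big /=; apply: eq_bigr => w _.
rewrite (bigD1 (nseq_tuple z false)) //= big1 ?addr0.
  by rewrite /vac nseqD -catA vchain_cat0.
move=> u nu; rewrite /vac -[in X in chain _ _ _ X _]sts.
have [->|] := eqVneq (chain (z + n) (@vstrip F) ts
   (nseq (size ts + size ts) false ++ nseq k true) (u ++ w)) 0.
  by rewrite mulr0.
rewrite {2}sts => /chain_leading[v /eqP].
rewrite eqseq_cat ?size_tuple ?size_nseq // => /andP[/eqP Eu _].
by case/eqP: nu; apply: val_inj.
Qed.

Lemma unitsP (ts : seq F) : all (predC1 0) ts ->
  forall t, t \in ts -> exists t', t * t' = 1.
Proof. by move=> /allP H t /H /= t0; exists t^-1; rewrite divff. Qed.

(** Both numbers are coefficients of the vertical chains from [la] to [nu], which do not see the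
    padding. *)
Lemma tripuz_pad n z k (la mu nu : seq bool) : n = (z + k)%N ->
  size la = n -> size mu = n -> size nu = n -> ones la = k -> ones mu = k ->
  tripuz F (nseq z false ++ la) (nseq z false ++ mu) (nseq z false ++ nu)
  = tripuz F la mu nu.
Proof.
move=> En sl sm sn ol om; apply/eqP; rewrite -subr_eq0; apply/eqP.
pose c m := tripuz F (nseq z false ++ la) (nseq z false ++ m) (nseq z false ++ nu)
   - tripuz F la m nu.
apply: (@vchain_free n z k c) => // ts sts ts0.
under eq_bigr => w _ do rewrite mulrBl.
rewrite big_split /= sumrN -(vchain_expand (unitsP ts0) En) //.
rewrite -(vchain_pad n k (fun m => tripuz F (nseq z false ++ la) m (nseq z false ++ nu)) sts).
rewrite -(vchain_expand (unitsP ts0)) ?vchain_cat0 ?subrr ?En ?addnA //.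
- by rewrite size_cat size_nseq sl En addnA.
- by rewrite size_cat size_nseq sn En addnA.
- by rewrite ones_cat ones_nseq ol.
Qed.

(* Both sides of the Pieri rule, iterated [z] times from [la], are expanded in
   the vertical chains starting at [vac]. *)
Lemma hchain_mul n z k (xs : seq F) (la mu : seq bool) : n = (z + k)%N ->
  size xs = k -> size la = n -> size mu = n -> ones la = k -> ones mu = k ->
  chain n (@hstrip F) xs (vac z k) la * chain n (@hstrip F) xs (vac z k) mu
  = \sum_(nu : (z + n).-tuple bool)
      tripuz F (nseq z false ++ la) (nseq z false ++ mu) nu
      * chain (z + n) (@hstrip F) xs (vac (z + z) k) nu.
Proof.
move=> En sxs sl sm ol om; apply/eqP; rewrite -subr_eq0; apply/eqP.
pose c m := chain n (@hstrip F) xs (vac z k) la * chain n (@hstrip F) xs (vac z k) m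
  - \sum_(nu : (z + n).-tuple bool) tripuz F (nseq z false ++ la) (nseq z false ++ m) nu
      * chain (z + n) (@hstrip F) xs (vac (z + z) k) nu.
(* The variables [xs] are fixed; coefficients are compared in the variables [ts]. *)
apply: (@vchain_free n z k c) => // ts sts ts0.
have lek : (size xs <= k)%N by rewrite sxs.
pose E := \prod_(t <- ts) \prod_(x <- xs) (1 + t * x).
(* The dual Cauchy identity, as the Pieri rule iterated from the empty partition. *)
have E1 : E = \sum_(w : n.-tuple bool) chain n (@vstrip F) ts (vac z k) w
    * chain n (@hstrip F) xs (vac z k) w.
  have := pieri_iter (n := n) (z := 0) (ts := ts) (w := vac z k) lek.
  rewrite sts addn0 chain_vac // mulr1; apply; rewrite ?size_vac //.
  by exists (nseq k true).
have E2 : E * chain n (@hstrip F) xs (vac z k) la = \sum_(nu : (z + n).-tuple bool)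
    chain (z + n) (@vstrip F) ts (nseq z false ++ la) nu
    * chain (z + n) (@hstrip F) xs (vac (z + z) k) nu.
  have := pieri_iter (n := (z + n)%N) (z := z) (ts := ts) (w := nseq z false ++ la) lek.
  rewrite sts {1}/vac nseqD -catA chain_cat0; apply.
  - by rewrite En addnA.
  - by rewrite size_cat size_nseq sl.
  by exists la.
under eq_bigr => w _ do rewrite mulrBl -mulrA.
rewrite big_split /= sumrN -mulr_sumr.
under eq_bigr => w _ do rewrite mulrC.
rewrite -E1 mulrC E2; apply/eqP; rewrite subr_eq0; apply/eqP.
under [RHS]eq_bigr => w _ do rewrite mulr_suml.
rewrite [RHS]exchange_big /=; apply: eq_bigr => nu _.
rewrite (vchain_expand (k := k) (z := (z + z)%N) (unitsP ts0)) ?size_tuple //.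
- rewrite (vchain_pad n k (fun m => tripuz F (nseq z false ++ la) m nu) sts) mulr_suml.
  by apply: eq_bigr => w _; ring.
- by rewrite En addnA.
- by rewrite size_cat size_nseq sl.
- by rewrite ones_cat ones_nseq ol.
Qed.

(** [hchain_mul] expands the product in a box with twice as many columns. When the product is known
    to lie in the small box, extending [D] by 0 makes the two expansions comparable. *)
Lemma tripuz_coef n z k (la mu : seq bool) (D : seq bool -> F) : n = (z + k)%N ->
  size la = n -> size mu = n -> ones la = k -> ones mu = k ->
  (forall xs, size xs = k -> all (predC1 0) xs ->
    chain n (@hstrip F) xs (vac z k) la * chain n (@hstrip F) xs (vac z k) mu
    = \sum_(nu : n.-tuple bool) D nu * chain n (@hstrip F) xs (vac z k) nu) ->
  forall nu, size nu = n -> ones nu = k -> D nu = tripuz F la mu nu.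
Proof.
move=> En sl sm ol om HD nu sn on.
pose D' w := if take z w == nseq z false then D (drop z w) else 0.
pose c w := D' w - tripuz F (nseq z false ++ la) (nseq z false ++ mu) w.
have : c (nseq z false ++ nu) = 0.
  apply: (@hchain_free (z + n) (z + z) k c) => [|xs sxs xs0||].
  - by rewrite En addnA.
  - under eq_bigr => w _ do rewrite mulrBl.
    rewrite big_split /= sumrN -hchain_mul // HD //; apply/eqP; rewrite subr_eq0; apply/eqP.
    rewrite (sum_tuple_cat z n (fun w => D' w * chain (z + n) (@hstrip F) xs (vac (z + z) k) w)).
    rewrite exchange_big /=; apply: eq_bigr => w _.
    rewrite (bigD1 (nseq_tuple z false)) //= big1 ?addr0 => [|u nu'].
      rewrite /D' take_size_cat ?drop_size_cat ?size_nseq // eqxx.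
      by rewrite /vac nseqD -catA chain_cat0.
    rewrite /D' take_size_cat ?size_tuple //; case: eqP => [Eu|]; last by rewrite mul0r.
    by case/eqP: nu'; apply: val_inj.
  - by rewrite size_cat size_nseq sn.
  - by rewrite ones_cat ones_nseq on.
rewrite /c /D' take_size_cat ?drop_size_cat ?size_nseq // eqxx => /eqP.
by rewrite subr_eq0 => /eqP ->; apply: tripuz_pad En _ _ _ _ _.
Qed.

(** Inherited from the commutativity of the product in [hchain_mul]; puzzles have no evident
    symmetry of this kind. *)
Lemma tripuzC n k (la mu nu : seq bool) :
  size la = n -> size mu = n -> size nu = n ->
  ones la = k -> ones mu = k -> ones nu = k ->
  tripuz F la mu nu = tripuz F mu la nu.
Proof.
move=> sl sm sn ol om on; pose z := (n - k)%N.
have En : n = (z + k)%N by have := ones_zeros la; rewrite ol sl /z; lia.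
rewrite -[LHS](tripuz_pad En) // -[RHS](tripuz_pad En) //.
pose c w := tripuz F (nseq z false ++ la) (nseq z false ++ mu) w
  - tripuz F (nseq z false ++ mu) (nseq z false ++ la) w.
apply/eqP; rewrite -subr_eq0; apply/eqP.
apply: (@hchain_free (z + n) (z + z) k c) => [|xs sxs xs0||].
- by rewrite {1}En addnA.
- under eq_bigr => w _ do rewrite mulrBl.
  by rewrite big_split /= sumrN -!hchain_mul // mulrC subrr.
- by rewrite size_cat size_nseq sn.
- by rewrite ones_cat ones_nseq on.
Qed.

(** State [true] at a cut means that one 1 has moved across it to the left. *)
Lemma vstrip_aut_ones (t : F) i u w j :
  aut (vstrip_step t) i u w j != 0 -> (i + ones w = ones u + j)%N.
Proof.
elim: u w i => [|a u IH] [|b w] i /=; rewrite ?eqxx //.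
  by case: (i =P j) => [->|]; rewrite ?eqxx // addn0.
case/sum_neq0 => m /mulf_neq0_pz[Hm /IH].
rewrite /ones /= -/(ones u) -/(ones w) => H.
have : (i + b = a + m)%N.
  by move: Hm; rewrite /vstrip_step; case: i a b m {H} => [] [] [] []; rewrite /= ?eqxx.
lia.
Qed.

(** 1s cross the cut only from right to left, so equal counts at the two ends of the chain forbid
    every crossing. *)
Lemma vchain_cat a c (ts : seq F) (u v u' v' : seq bool) :
  size u = a -> size v = c -> size u' = a -> size v' = c -> ones u = ones u' ->
  chain (a + c) (@vstrip F) ts (u ++ v) (u' ++ v')
  = chain a (@vstrip F) ts u u' * chain c (@vstrip F) ts v v'.
Proof.
move=> su sv su' sv' ou.
(* The vanishing half discards the intermediate words with too few 1s on the left. *)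
suff: (ones u' = ones u -> chain (a + c) (@vstrip F) ts (u ++ v) (u' ++ v')
    = chain a (@vstrip F) ts u u' * chain c (@vstrip F) ts v v')
  /\ ((ones u' < ones u)%N -> chain (a + c) (@vstrip F) ts (u ++ v) (u' ++ v') = 0).
  by case=> -> //.
move: su' sv' {ou}; elim: ts u' v' => [|t ts IH] u' v' su' sv' /=.
  rewrite eqseq_cat ?su ?su' // -natrM mulnb; split=> // lt.
  by case: (u =P u') lt => [->|//]; rewrite ltnn.
have vE (x : a.-tuple bool) (y : c.-tuple bool) : vstrip t (x ++ y) (u' ++ v')
    = vstrip t x u' * vstrip t y v'
      + aut (vstrip_step t) false x u' true * aut (vstrip_step t) true y v' false.
  by rewrite /vstrip aut_cat ?size_tuple ?su' // sum_bool addrC.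
have lt0 (x : a.-tuple bool) (y : c.-tuple bool) : (ones u' < ones x)%N ->
    vstrip t (x ++ y) (u' ++ v') = 0.
  move=> lt; rewrite vE.
  have -> : vstrip t x u' = 0.
    by apply/eqP; apply: contraTT lt => /vstrip_aut_ones; lia.
  have -> : aut (vstrip_step t) false x u' true = 0.
    by apply/eqP; apply: contraTT lt => /vstrip_aut_ones; lia.
  by rewrite !mul0r addr0.
rewrite (sum_tuple_cat a c (fun w => chain (a + c) (@vstrip F) ts (u ++ v) w * vstrip t w (u' ++ v'))).
split=> [Eu|lt]; last first.
  rewrite big1 // => x _; rewrite big1 // => y _.
  have [lx|lx] := ltnP (ones x) (ones u).
    by rewrite (IH x y _ _).2 ?size_tuple ?mul0r.
  by rewrite lt0 ?mulr0 //; apply: leq_trans lt lx.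
rewrite mulr_suml; apply: eq_bigr => x _.
rewrite mulr_sumr; apply: eq_bigr => y _.
case: (ltngtP (ones x) (ones u)) => lx.
- rewrite (IH x y _ _).2 ?size_tuple // mul0r.
  have -> : vstrip t x u' = 0.
    by apply/eqP; apply: contraTT lx => /vstrip_aut_ones; lia.
  by rewrite mulr0 mul0r.
- rewrite lt0 ?Eu // mulr0.
  have -> : vstrip t x u' = 0.
    by apply/eqP; apply: contraTT lx => /vstrip_aut_ones; lia.
  by rewrite mulr0 mul0r.
rewrite (IH x y _ _).1 ?size_tuple // vE.
have -> : aut (vstrip_step t) false x u' true = 0.
  by apply/eqP; apply: contra_eqT lx => /vstrip_aut_ones; lia.
by ring.
Qed.

Lemma vchain_mul a0 a1 c0 c1 (ts : seq F) (la mu : seq bool) :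
  let a := (a0 + a1)%N in let c := (c0 + c1)%N in
  all (predC1 0) ts -> size la = a -> size mu = c -> ones la = a1 -> ones mu = c1 ->
  chain a (@vstrip F) ts (vac a0 a1) la * chain c (@vstrip F) ts (vac c0 c1) mu
  = \sum_(nu : (a + c).-tuple bool)
      tripuz F (nseq c0 false ++ la ++ nseq c1 true) (nseq a0 false ++ mu ++ nseq a1 true) nu
      * chain (a + c) (@vstrip F) ts (vac (a0 + c0) (a1 + c1)) nu.
Proof.
move=> a c ts0 sl sm ol om.
have Eac : (a + c = (a0 + c0) + (a1 + c1))%N by rewrite /a /c; lia.
(* The same product is the chain of a skew shape in two disjoint pieces, whose expansion already
   lies in the box of length [a + c], as [tripuz_coef] requires. *)
pose D k := tripuz F (vac a0 a1 ++ vac c0 c1) k (la ++ mu).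
have HD us : all (predC1 0) us ->
    chain a (@vstrip F) us (vac a0 a1) la * chain c (@vstrip F) us (vac c0 c1) mu
    = \sum_(k : (a + c).-tuple bool) D k * chain (a + c) (@vstrip F) us (vac (a0 + c0) (a1 + c1)) k.
  move=> us0; rewrite -vchain_cat ?size_vac ?ones_vac //.
  apply: vchain_expand (unitsP us0) Eac _ _ _.
  - by rewrite size_cat !size_vac.
  - by rewrite size_cat sl sm.
  - by rewrite ones_cat !ones_vac.
pose la' := nseq c0 false ++ la ++ nseq c1 true.
pose mu' := nseq a0 false ++ mu ++ nseq a1 true.
have sl' : size la' = (a + c)%N by rewrite !size_cat !size_nseq sl /a /c; lia.
have sm' : size mu' = (a + c)%N by rewrite !size_cat !size_nseq sm /a /c; lia.
have ol' : ones la' = (a1 + c1)%N by rewrite !ones_cat !ones_nseq ol; lia.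
have om' : ones mu' = (a1 + c1)%N by rewrite !ones_cat !ones_nseq om; lia.
have zl : zeros la' = (a0 + c0)%N by have := ones_zeros la'; rewrite ol' sl'; lia.
have zm : zeros mu' = (a0 + c0)%N by have := ones_zeros mu'; rewrite om' sm'; lia.
have cl us : chain (a + c) (@vstrip F) us (vac (a0 + c0) (a1 + c1)) la'
    = chain a (@vstrip F) us (vac a0 a1) la.
  have -> : (a + c = c0 + (a + c1))%N by rewrite /a /c; lia.
  by rewrite /la' /vac [(a0 + c0)%N]addnC !nseqD -catA [nseq a0 _ ++ _]catA vchain_cat0 vchain_cat1.
have cm us : chain (a + c) (@vstrip F) us (vac (a0 + c0) (a1 + c1)) mu'
    = chain c (@vstrip F) us (vac c0 c1) mu.
  have -> : (a + c = a0 + (c + a1))%N by rewrite /a /c; lia.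
  by rewrite /mu' /vac [(a1 + c1)%N]addnC !nseqD -catA [nseq c0 _ ++ _]catA vchain_cat0 vchain_cat1.
rewrite HD //; apply: eq_bigr => nu _.
have [->|] := eqVneq (chain (a + c) (@vstrip F) ts (vac (a0 + c0) (a1 + c1)) nu) 0.
  by rewrite !mulr0.
rewrite chain_star => /chain_ones; rewrite !ones_star.
have -> : zeros (vac (a0 + c0) (a1 + c1)) = (a0 + c0)%N.
  by rewrite zeros_cat !zeros_nseq mul1n mul0n addn0.
move=> /esym zn; congr (_ * _).
have on : ones nu = (a1 + c1)%N by have := ones_zeros nu; rewrite zn size_tuple; lia.
(* [star] turns vertical chains into horizontal ones but also exchanges the NW and NE words;
   commuting them first compensates. *)
rewrite (tripuzC (n := (a + c)%N) (k := (a1 + c1)%N)) ?size_tuple //.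
rewrite -tripuz_star ?size_tuple ?sl' ?sm' //.
rewrite -[in LHS](starK nu).
apply: (@tripuz_coef (a + c) (a1 + c1) (a0 + c0) (star la') (star mu') (D \o star)).
- by rewrite Eac addnC.
- by rewrite size_star.
- by rewrite size_star.
- by rewrite ones_star.
- by rewrite ones_star.
- move=> us sus us0; rewrite -star_vac -!chain_star cl cm HD //.
  rewrite (sum_star _ (fun k => D k * chain (a + c) (@vstrip F) us (vac (a0 + c0) (a1 + c1)) k)).
  by apply: eq_bigr => k _; rewrite chain_star starK.
- by rewrite size_star size_tuple.
- by rewrite ones_star.
Qed.

Lemma tripuz_split a0 a1 c0 c1 (al be ga de nu : seq bool) :
  let a := (a0 + a1)%N in let c := (c0 + c1)%N in
  size al = a -> size be = a -> size ga = c -> size de = c -> size nu = (a + c)%N ->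
  ones al = a1 -> ones be = a1 -> ones ga = c1 -> ones de = c1 -> ones nu = (a1 + c1)%N ->
  tripuz F (al ++ ga) nu (be ++ de)
  = \sum_(la : a.-tuple bool | ones la == a1) \sum_(mu : c.-tuple bool | ones mu == c1)
      tripuz F (nseq c0 false ++ la ++ nseq c1 true) (nseq a0 false ++ mu ++ nseq a1 true) nu
      * tripuz F al la be * tripuz F ga mu de.
Proof.
move=> a c sa sb sg sd sn oa ob og od on.
have Eac : (a + c = (a0 + c0) + (a1 + c1))%N by rewrite /a /c; lia.
pose G (la mu w : seq bool) :=
   tripuz F (nseq c0 false ++ la ++ nseq c1 true) (nseq a0 false ++ mu ++ nseq a1 true) w.
pose c' w := tripuz F (al ++ ga) w (be ++ de)
  - \sum_(la : a.-tuple bool | ones la == a1) \sum_(mu : c.-tuple bool | ones mu == c1)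
      G la mu w * tripuz F al la be * tripuz F ga mu de.
apply/eqP; rewrite -subr_eq0; apply/eqP.
apply: (@vchain_free (a + c) (a0 + c0) (a1 + c1) c') => // ts sts ts0.
under eq_bigr => w _ do rewrite mulrBl.
rewrite big_split /= sumrN -(vchain_expand (unitsP ts0) Eac); last 3 first.
- by rewrite size_cat sa sg.
- by rewrite size_cat sb sd.
- by rewrite ones_cat oa og.
rewrite vchain_cat ?oa ?ob // (vchain_expand (unitsP ts0) (erefl a)) //.
rewrite (vchain_expand (unitsP ts0) (erefl c)) //.
apply/eqP; rewrite subr_eq0; apply/eqP.
under [RHS]eq_bigr => w _ do rewrite mulr_suml.
rewrite [RHS]exchange_big /=.
(* Used to discard the words with a wrong number of 1s; the second alternative allows a statement
   for a variable length [n]. *)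
have nz p q n (u : n.-tuple bool) : ones u != q -> chain n (@vstrip F) ts (vac p q) u = 0 \/ n != (p + q)%N.
  move=> nu'; case: (n =P (p + q)%N) => [En|]; [left|by right].
  apply/eqP; apply: contraNT nu'; rewrite chain_star star_vac => /chain_ones.
  rewrite ones_vac ones_star => Ep; apply/eqP; have := ones_zeros u.
  by have := size_tuple u; lia.
rewrite mulr_suml [LHS](bigID (fun la : a.-tuple bool => ones la == a1)) /=.
rewrite [X in _ + X]big1 ?addr0; last first.
  move=> la nla; case: (nz a0 a1 a la nla) => [->|]; last by rewrite eqxx.
  by rewrite mulr0 mul0r.
apply: eq_bigr => la /eqP ol.
under [RHS]eq_bigr => w _ do rewrite mulr_suml.
rewrite [RHS]exchange_big /= mulr_sumr [LHS](bigID (fun mu : c.-tuple bool => ones mu == c1)) /=.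
rewrite [X in _ + X]big1 ?addr0; last first.
  move=> mu nmu; case: (nz c0 c1 c mu nmu) => [->|]; last by rewrite eqxx.
  by rewrite !mulr0.
apply: eq_bigr => mu /eqP om.
transitivity (tripuz F al la be * tripuz F ga mu de *
  (chain a (@vstrip F) ts (vac a0 a1) la * chain c (@vstrip F) ts (vac c0 c1) mu)).
  by ring.
rewrite vchain_mul ?size_tuple // mulr_sumr.
by apply: eq_bigr => w _; rewrite /G; ring.
Qed.

End Products.

(** * Semistandard tableaux *)

Section Cells.
Variable la : seq nat.

Lemma cell_inj (c c' : cell la) :
  tag c = tag c' :> nat -> tagged c = tagged c' :> nat -> c = c'.
Proof.
case: c c' => [i j] [i' j'] /= /val_inj Ei; subst i'.
by move=> /val_inj ->.
Qed.

Definition cell_at (i j : nat) : option (cell la) :=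
  [pick c : cell la | (tag c == i :> nat) && (tagged c == j :> nat)].

Lemma cell_at_cell (c : cell la) : cell_at (tag c) (tagged c) = Some c.
Proof.
rewrite /cell_at; case: pickP => [c' /andP[/eqP Ei /eqP Ej]|/(_ c)].
  by congr Some; apply: cell_inj.
by rewrite !eqxx.
Qed.

Lemma cell_at_in (i j : nat) : (i < size la)%N -> (j < nth 0%N la i)%N ->
  exists2 c : cell la, cell_at i j = Some c & tag c = i :> nat /\ tagged c = j :> nat.
Proof.
move=> Hi Hj.
pose c : cell la := Tagged (fun i : 'I_(size la) => 'I_(nth 0%N la i)) (Ordinal Hj : 'I_(nth 0%N la (Ordinal Hi))).
by exists c => //; rewrite -(cell_at_cell c).
Qed.

Lemma cell_in (c : cell la) :
  (tag c < size la)%N /\ (tagged c < nth 0%N la (tag c))%N.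
Proof. by split; apply: ltn_ord. Qed.

Lemma cell_at_out (i j : nat) : (nth 0%N la i <= j)%N -> cell_at i j = None.
Proof.
move=> H; rewrite /cell_at; case: pickP => // c /andP[/eqP Ei /eqP Ej].
by rewrite -Ei in H; have [_] := cell_in c; rewrite Ej ltnNge H.
Qed.

(** Fillings become total functions of the position, so that tableaux of different shapes can be
    compared. *)
Definition entry (V : Type) (d : V) (T : cell la -> V) (i j : nat) : V :=
  if cell_at i j is Some c then T c else d.

Lemma entryE (V : Type) (d : V) T (c : cell la) : entry d T (tag c) (tagged c) = T c.
Proof. by rewrite /entry cell_at_cell. Qed.

Lemma prod_cell (R : comPzSemiRingType) (G : nat -> nat -> R) :
  \prod_(c : cell la) G (tag c) (tagged c)
  = \prod_(0 <= i < size la) \prod_(0 <= j < nth 0%N la i) G i j.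
Proof.
rewrite big_mkord; under [RHS]eq_bigr => i _ do rewrite big_mkord.
rewrite (sig_big_dep xpredT (fun=> xpredT) (fun (i : 'I_(size la)) (j : 'I_(nth 0%N la i)) => G i j)) /=.
by apply: eq_bigl => -[].
Qed.

End Cells.

(* The shapes [mu] such that [la/mu] is a horizontal strip. *)
Fixpoint hshapes (la : seq nat) : seq (seq nat) :=
  if la is l :: la' then
    [seq m :: mu | m <- iota (head 0 la') (l - head 0 la').+1, mu <- hshapes la']%N
  else [:: [::]].

Lemma hshapes_cons l la : hshapes (l :: la)
  = [seq m :: mu | m <- iota (head 0 la) (l - head 0 la).+1, mu <- hshapes la]%N.
Proof. by []. Qed.

Lemma mem_hshapes la mu : sorted geq la ->
  (mu \in hshapes la) = (size mu == size la) &&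
    all (fun i => nth 0 la i.+1 <= nth 0 mu i <= nth 0 la i)%N (iota 0 (size la)).
Proof.
elim: la mu => [|l la IH] mu sla; first by rewrite inE; case: mu.
have {}IH mu' := IH mu' (path_sorted sla).
rewrite hshapes_cons [size (_ :: _)]/= [iota 0 _]/= [all _ _]/=.
have hl : (head 0 la <= l)%N by case: (la) sla => //= a la' /andP[].
apply/allpairsPdep/idP => [[m [nu [Hm Hnu ->]]]|].
  move: Hnu; rewrite IH => /andP[/eqP sn Hn]; rewrite /= sn eqxx /=.
  move: Hm; rewrite mem_iota addnS subnKC // ltnS nth0 => -> /=.
  by rewrite -[1%N]addn0 iotaDl all_map.
case: mu => [|m mu] //; rewrite eqSS => /and3P[sm Hm Hmu].
exists m, mu; split=> //.
  by rewrite mem_iota addnS subnKC // ltnS -nth0.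
by rewrite IH sm; move: Hmu; rewrite -[1%N]addn0 iotaDl all_map.
Qed.

Lemma hshapesP la mu : sorted geq la ->
  reflect (size mu = size la /\ forall i, nth 0 la i.+1 <= nth 0 mu i <= nth 0 la i)%N
    (mu \in hshapes la).
Proof.
move=> sla; rewrite mem_hshapes //; apply: (iffP andP) => [[/eqP sm /allP H]|[sm H]].
  split=> // i; have [lt|ge] := ltnP i (size la); first by apply: H; rewrite mem_iota.
  by rewrite !nth_default ?sm // leqW.
by split; [apply/eqP | apply/allP => i _].
Qed.

Lemma uniq_hshapes la : uniq (hshapes la).
Proof.
elim: la => [|l la IH] //; rewrite hshapes_cons.
apply: allpairs_uniq; rewrite ?iota_uniq //.
by move=> [a b] [a' b'] _ _ /= [-> ->].
Qed.

Lemma nth_sorted_geq la i j : sorted geq la -> (i <= j)%N ->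
  (nth 0 la j <= nth 0 la i)%N.
Proof.
move=> sla ij; have [lt|ge] := ltnP j (size la); last by rewrite nth_default.
have := sorted_leq_nth (leT := geq) _ _ 0%N sla; apply=> //.
- by move=> a b c ab bc; apply: leq_trans bc ab.
- by move=> a; apply: leqnn.
- by rewrite inE; apply: leq_ltn_trans lt.
Qed.

Section Tableaux.
Variables (R : comNzRingType) (M : nat) (x : 'I_M -> R).

(** The alphabet ['I_M] is fixed and only the bound [N] varies, so the induction on [N] does not
    change the type of the entries. *)
Definition tableau_sum (N : nat) (la : seq nat) : R :=
  \sum_(T : {ffun cell la -> 'I_M} | semistandard T && [forall c, T c < N]%N)
    \prod_(c : cell la) x (T c).

Lemma tableau_sum0 la : tableau_sum 0 la = (all (pred1 0%N) la)%:R.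
Proof.
have [/allP l0|/allPn[l lla l0]] := boolP (all _ _); last first.
  rewrite /tableau_sum big_pred0 // => T; apply/negP => /andP[_ /forallP H].
  have Hi : (index l la < size la)%N by rewrite index_mem.
  have Hj : (0 < nth 0%N la (index l la))%N by rewrite nth_index // lt0n.
  by have [c _ _] := cell_at_in Hi Hj; have := H c.
have noc (c : cell la) : False.
  have [H1 H2] := cell_in c; have /eqP E := l0 _ (mem_nth 0%N H1).
  by have := leq_trans H2 (eq_leq E).
have T0 : {ffun cell la -> 'I_M} by apply: finfun => c; case: (noc c).
rewrite /tableau_sum (big_pred1 T0) => [|T /=].
  by rewrite big1 // => c _; case: (noc c).
have -> : T == T0 by apply/eqP/ffunP => c; case: (noc c).
by apply/andP; split; apply/forallP => c; case: (noc c).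
Qed.

(** The branching rule: the cells with the largest entry [N] form a horizontal strip, and the others
    a tableau of shape [mu]. *)
Lemma tableau_sumS N la : (N < M)%N -> sorted geq la ->
  forall o : 'I_M, o = N :> nat ->
  tableau_sum N.+1 la
  = \sum_(mu <- hshapes la) x o ^+ (sumn la - sumn mu) * tableau_sum N mu.
Proof.
move=> ltNM sla o oN.
pose fits (mu : seq nat) (T : {ffun cell la -> 'I_M}) :=
  [forall c, (T c < N)%N == (tagged c < nth 0 mu (tag c))%N].
(* Each tableau fits exactly one [mu], the shape of its entries below [N]. *)
transitivity (\sum_(T : {ffun cell la -> 'I_M} | semistandard T && [forall c, T c < N.+1]%N)
   \sum_(mu <- hshapes la | fits mu T) \prod_(c : cell la) x (T c)).
  apply: eq_bigr => T /andP[/forallP ssT /forallP ltT].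
  pose e i j : nat := entry o T i j.
  have eT (c : cell la) : e (tag c) (tagged c) = T c by rewrite /e entryE.
  have e_row i j j' : (i < size la)%N -> (j <= j')%N -> (j' < nth 0%N la i)%N -> (e i j <= e i j')%N.
    move=> Hi jj Hj'; have [c Ec [c1 c2]] := cell_at_in Hi (leq_ltn_trans jj Hj').
    have [c' Ec' [c1' c2']] := cell_at_in Hi Hj'.
    rewrite /e /entry Ec Ec'; have /forallP/(_ c')/andP[/implyP H _] := ssT c.
    by apply: H; rewrite c2 c2' jj andbT; apply/eqP/val_inj; rewrite /= c1 c1'.
  have e_col i j : (i.+1 < size la)%N -> (j < nth 0%N la i.+1)%N -> (e i j < e i.+1 j)%N.
    move=> Hi Hj; have [c' Ec' [c1' c2']] := cell_at_in Hi Hj.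
    have [c Ec [c1 c2]] := cell_at_in (ltnW Hi) (leq_trans Hj (nth_sorted_geq sla (leqnSn i))).
    rewrite /e /entry Ec Ec'; have /forallP/(_ c')/andP[_ /implyP H] := ssT c.
    by apply: H; rewrite c2 c2' c1 c1' ltnSn eqxx.
  have e_lt i j : (i < size la)%N -> (j < nth 0%N la i)%N -> (e i j <= N)%N.
    by move=> Hi Hj; have [c Ec _] := cell_at_in Hi Hj; rewrite /e /entry Ec -ltnS.
  (* Rows increase weakly, so the entries below [N] are the first [m i] of row [i]. *)
  pose m i := find (fun j => N <= e i j)%N (iota 0 (nth 0%N la i)).
  have mle i : (m i <= nth 0%N la i)%N by rewrite -[leqRHS](size_iota 0) find_size.
  have m_lt i j : (i < size la)%N -> (j < nth 0%N la i)%N -> (e i j < N)%N = (j < m i)%N.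
    move=> Hi Hj; apply/idP/idP => [H|jm].
      rewrite ltnNge; apply/negP => mj; have mla := leq_ltn_trans mj Hj.
      have := nth_find 0%N (a := fun j => (N <= e i j)%N) (s := iota 0 (nth 0%N la i)).
      rewrite has_find size_iota => /(_ mla); rewrite nth_iota // add0n => Hm.
      by have := leq_ltn_trans (leq_trans Hm (e_row _ _ _ Hi mj Hj)) H; rewrite ltnn.
    have := before_find 0%N (a := fun j => (N <= e i j)%N) (s := iota 0 (nth 0%N la i)) jm.
    by rewrite nth_iota // add0n leqNgt => /negbFE.
  pose mu := mkseq m (size la).
  have nmu i : (i < size la)%N -> nth 0%N mu i = m i by move=> Hi; rewrite nth_mkseq.
  have muP : mu \in hshapes la.
    apply/hshapesP => //; split=> [|i]; first by rewrite size_mkseq.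
    have [Hi|Hi] := ltnP i (size la); last first.
      by rewrite !nth_default ?size_mkseq // leqW.
    rewrite nmu // mle andbT.
    have [Hi'|Hi'] := ltnP i.+1 (size la); last by rewrite nth_default.
    (* Otherwise the entry [N] at position [m i] has a cell below it, whose entry would be larger
       than [N]. *)
    rewrite leqNgt; apply/negP => H.
    have Hm := leq_trans H (nth_sorted_geq sla (leqnSn i)).
    have := m_lt i (m i) Hi Hm; rewrite ltnn => /negP; apply.
    by apply: leq_trans (e_col _ _ Hi' H) (e_lt _ _ Hi' H).
  have fitsE nu : nu \in hshapes la -> fits nu T = (nu == mu).
    move=> /hshapesP[] // snu Hnu; apply/forallP/eqP => [H|-> c]; last first.
      have [c1 c2] := cell_in c.
      by rewrite nmu // -m_lt // eT.
    apply: (@eq_from_nth _ 0%N); first by rewrite size_mkseq.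
    rewrite snu => i Hi; rewrite nmu //.
    have H' j : (j < nth 0%N la i)%N -> (j < nth 0%N nu i)%N = (j < m i)%N.
      move=> Hj; rewrite -m_lt //; have [c Ec [c1 c2]] := cell_at_in Hi Hj.
      by rewrite /e /entry Ec (eqP (H c)) c2 c1.
    have /andP[_ H2] := Hnu i; have H3 := mle i.
    case: (ltngtP (nth 0%N nu i) (m i)) => // lt.
      by have := H' _ (leq_trans lt H3); rewrite ltnn lt.
    by have := H' _ (leq_trans lt H2); rewrite ltnn lt.
  rewrite [RHS]big_mkcond /= (bigD1_seq mu) ?uniq_hshapes //= fitsE // eqxx.
  rewrite [X in _ + X]big_seq_cond [X in _ + X]big1 ?addr0 // => nu /andP[Hnu nmu'].
  by rewrite fitsE // (negbTE nmu').
rewrite (exchange_big_dep xpredT) //=.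
apply: eq_big_seq => mu /hshapesP[] // smu Hmu.
(* The default [o] of [entry] fills the added strip with the letter [N]. *)
pose ext (T : {ffun cell mu -> 'I_M}) : {ffun cell la -> 'I_M} :=
  [ffun c : cell la => entry o T (tag c) (tagged c)].
pose res (T : {ffun cell la -> 'I_M}) : {ffun cell mu -> 'I_M} :=
  [ffun c : cell mu => entry o T (tag c) (tagged c)].
have mu_la (c : cell mu) : exists2 c' : cell la, cell_at la (tag c) (tagged c) = Some c' &
    tag c' = tag c :> nat /\ tagged c' = tagged c :> nat.
  have [c1 c2] := cell_in c; apply: cell_at_in; first by rewrite -smu.
  by apply: leq_trans c2 _; case/andP: (Hmu (tag c)).
have in_mu (c : cell la) : (tagged c < nth 0%N mu (tag c))%N ->
    exists2 c' : cell mu, cell_at mu (tag c) (tagged c) = Some c' &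
    tag c' = tag c :> nat /\ tagged c' = tagged c :> nat.
  by move=> H; apply: cell_at_in => //; rewrite smu; case: (cell_in c).
have out_mu (c : cell la) : (nth 0%N mu (tag c) <= tagged c)%N -> cell_at mu (tag c) (tagged c) = None.
  exact: cell_at_out.
have resK T : res (ext T) = T.
  apply/ffunP => c; rewrite ffunE /entry; have [c' -> [c1 c2]] := mu_la c.
  by rewrite ffunE c2 c1 entryE.
rewrite (reindex_onto ext res); last first.
  move=> T /andP[/andP[_ /forallP ltT] /forallP fT]; apply/ffunP => c; rewrite ffunE /entry.
  have [Hc|Hc] := ltnP (tagged c) (nth 0%N mu (tag c)).
    have [c' -> [c1 c2]] := in_mu c Hc.
    by rewrite ffunE c2 c1 entryE.
  have Tc : (T c < N)%N = false by rewrite (eqP (fT c)) ltnNge Hc.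
  rewrite out_mu //; apply: val_inj; rewrite /= oN; apply/eqP.
  by rewrite eqn_leq -[(T c <= N)%N]ltnS ltT andbT leqNgt Tc.
rewrite mulr_sumr; apply: eq_big => [T|T _].
  rewrite resK eqxx andbT.
  have extE (c : cell la) c' : cell_at mu (tag c) (tagged c) = Some c' -> ext T c = T c'.
    by move=> E; rewrite ffunE /entry E.
  have extE' (c : cell mu) c' : cell_at la (tag c) (tagged c) = Some c' -> ext T c' = T c.
    by move=> E; have [c'' E' [c1 c2]] := mu_la c; move: E; rewrite E' => -[<-];
      rewrite ffunE c2 c1 entryE.
  have ext_out (c : cell la) : (nth 0%N mu (tag c) <= tagged c)%N -> ext T c = N :> nat.
    by move=> H; rewrite ffunE /entry out_mu.
  apply/idP/idP => [/andP[/andP[/forallP ssT _] /forallP fT]|/andP[/forallP ssT /forallP ltT]].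
    apply/andP; split; apply/forallP => c; have [d Ed [d1 d2]] := mu_la c; last first.
      rewrite -(extE' _ _ Ed) (eqP (fT d)) d2 d1; by case: (cell_in c).
    apply/forallP => c'; have [d' Ed' [d1' d2']] := mu_la c'.
    rewrite -(extE' _ _ Ed) -(extE' _ _ Ed').
    have /forallP/(_ d') := ssT d; rewrite d2 d2' d1 d1'.
    by rewrite -!(inj_eq val_inj) /= d1 d1'.
  have lt_in (c : cell la) : (tagged c < nth 0%N mu (tag c))%N -> (ext T c < N)%N.
    by move=> /in_mu[c' Ec' _]; rewrite (extE _ _ Ec').
  have le_N (c : cell la) : (ext T c <= N)%N.
    by have [/lt_in/ltnW|/ext_out->] := ltnP (tagged c) (nth 0%N mu (tag c)).
  apply/andP; split; last first.
    apply/forallP => c; have [H|H] := ltnP (tagged c) (nth 0%N mu (tag c)).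
      by rewrite lt_in.
    by rewrite ext_out // ltnn.
  apply/andP; split; last by apply/forallP => c; rewrite ltnS.
  apply/forallP => c; apply/forallP => c'.
  have [H'|H'] := ltnP (tagged c') (nth 0%N mu (tag c')); last first.
    rewrite (ext_out c') // le_N implybT /=; apply/implyP => /andP[lt /eqP Ej].
    apply: lt_in; apply: leq_trans (_ : nth 0%N la (tag c).+1 <= _)%N; last by case/andP: (Hmu (tag c)).
    by rewrite Ej; apply: leq_trans (ltn_ord (tagged c')) _; apply: nth_sorted_geq.
  have [d' Ed' [d1' d2']] := in_mu c' H'.
  have Hc : (tag c <= tag c')%N -> (tagged c <= tagged c')%N -> (tagged c < nth 0%N mu (tag c))%N.
    move=> lt lj; apply: leq_ltn_trans lj _; apply: leq_trans H' _.
    move: lt; rewrite leq_eqVlt => /orP[/eqP -> //|lt].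
    have /andP[_ H1] := Hmu (tag c'); have /andP[H2 _] := Hmu (tag c).
    by apply: leq_trans H1 (leq_trans (nth_sorted_geq sla lt) H2).
  have Himp : (tag c <= tag c')%N -> (tagged c <= tagged c')%N ->
     ((tag c == tag c') && (tagged c <= tagged c') ==> (ext T c <= ext T c'))%N
     && ((tag c < tag c') && (tagged c == tagged c' :> nat) ==> (ext T c < ext T c'))%N.
    move=> lt lj; have [d Ed [d1 d2]] := in_mu c (Hc lt lj).
    rewrite (extE _ _ Ed) (extE _ _ Ed').
    have /forallP/(_ d') := ssT d; rewrite d2 d2' d1 d1'.
    by rewrite -!(inj_eq val_inj) /= d1 d1'.
  apply/andP; split; apply/implyP => /andP[H1 H2].
    by have /andP[/implyP-> //] := Himp (eq_leq (congr1 val (eqP H1))) H2; rewrite H1.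
  by have /andP[_ /implyP-> //] := Himp (ltnW H1) (eq_leq (eqP H2)); rewrite H1.
pose G := fun i j => x (entry o T i j).
transitivity (\prod_(c : cell la) G (tag c) (tagged c)).
  by apply: eq_bigr => c _; rewrite ffunE.
rewrite prod_cell.
under eq_big_nat => i /andP[_ Hi].
  have /andP[_ Hi'] := Hmu i.
  rewrite (big_cat_nat _ Hi') //=.
  rewrite [X in _ * X](eq_big_nat _ _ (F2 := fun=> x o)); last first.
    by move=> j /andP[Hj _]; rewrite /G /entry cell_at_out.
  rewrite big_const_nat iter_mulr_1.
  over.
rewrite /= big_split /= mulrC; congr (_ * _); last first.
  by rewrite -smu -prod_cell; apply: eq_bigr => c _; rewrite /G entryE.
rewrite prodrXr; congr (_ ^+ _).
have sE (s : seq nat) : sumn s = \sum_(0 <= i < size s) nth 0%N s i.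
  by rewrite sumnE (big_nth 0%N).
rewrite !sE smu -sumnB // => i _.
by case/andP: (Hmu i).
Qed.

End Tableaux.

(** * Tableaux as chains of horizontal strips on strings *)

Lemma size_string_partition w : size (string_partition w) = ones w.
Proof. by elim: w => [|[] w IH] //=; rewrite IH. Qed.

Lemma head_string_partition w : (head 0 (string_partition w) <= zeros w)%N.
Proof. by elim: w => [|[] w IH] //=; apply: leq_trans IH _; rewrite /zeros /=. Qed.

Lemma string_partition_sorted w : sorted geq (string_partition w).
Proof.
elim: w => [|[] w IH] //=; have := head_string_partition w.
by case: (string_partition w) IH => //= a s -> ->.
Qed.

Lemma sumn_hshapes la mu : sorted geq la -> mu \in hshapes la ->
  (sumn mu <= sumn la)%N.
Proof.
move=> sla /hshapesP[] // sm H; rewrite !sumnE (big_nth 0%N) [leqRHS](big_nth 0%N) sm.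
by apply: leq_sum => i _; case/andP: (H i).
Qed.

Lemma string_partition_vac z k w : size w = (z + k)%N -> ones w = k ->
  all (pred1 0%N) (string_partition w) = (vac z k == w).
Proof.
elim: w z k => [|[] w IH] z k.
- by case: z k => [|z] [|k].
- rewrite /ones /= -/(ones w) add1n; case: k => [|k] //; rewrite addnS => -[sw] [ow].
  have zw : zeros w = z by have := ones_zeros w; lia.
  rewrite zw (IH z k) //; by case: z sw {zw} => [|z] sw; rewrite /vac /= eqseq_cons.
- case: z => [|z] sw ow.
    by have := count_size id w; move: sw ow; rewrite /ones /=; lia.
  by rewrite /= eqseq_cons -(IH z k) //; move: sw => /= [].
Qed.

Lemma big_hshapes_cons (R : nmodType) l la (G : seq nat -> R) : (head 0 la <= l)%N ->
  \sum_(mu <- hshapes (l :: la)) G mu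
  = \sum_(head 0%N la <= m < l.+1) \sum_(mu <- hshapes la) G (m :: mu).
Proof.
by move=> hl; rewrite hshapes_cons big_allpairs_dep /index_iota subSn.
Qed.

Lemma aut_hstrip_zeros (R : comNzRingType) (x : R) i u w :
  aut (hstrip_step x) i u w false != 0 -> (zeros u + i = zeros w)%N.
Proof.
elim: u w i => [|a u IH] [|b w] i; rewrite ?eqxx //=.
  by case: i; rewrite ?eqxx.
case/sum_neq0 => m /mulf_neq0_pz[Hm /IH].
rewrite /zeros /= -/(zeros u) -/(zeros w) => H.
have : (~~ a + i = ~~ b + m)%N by move: Hm; case: i a b m {H} => [] [] [] []; rewrite /= ?eqxx.
lia.
Qed.

Section Branching.
Variable R : comNzRingType.
Variable x : R.

Let weight w mu := x ^+ (sumn (string_partition w) - sumn mu).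

(** In state [true] a 1 of the larger string waits for its partner, and [m] is the part that this
    partner will contribute; it is smaller than [zeros w] because the partner stands opposite a
    0. *)
Lemma sum_hstrip_aux w (G : seq nat -> R) :
  \sum_(u : (size w).-tuple bool) aut (hstrip_step x) false u w false * G (string_partition u)
    = \sum_(mu <- hshapes (string_partition w)) weight w mu * G mu
  /\
  \sum_(u : (size w).-tuple bool) aut (hstrip_step x) true u w false * G (string_partition u)
    = \sum_(head 0%N (string_partition w) <= m < zeros w) x ^+ (zeros w - m.+1)
        * \sum_(mu <- hshapes (string_partition w)) weight w mu * G (m :: mu).
Proof.
move: G; have sumE (G : seq nat -> R) i b w' : \sum_(u : (size w').+1.-tuple bool)
      aut (hstrip_step x) i u (b :: w') false * G (string_partition u)
    = \sum_a \sum_m hstrip_step x i a b m * \sum_(u : (size w').-tuple bool)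
      aut (hstrip_step x) m u w' false * G (string_partition (a :: u)).
  rewrite (sum_tupleS _ (fun u => aut (hstrip_step x) i u (b :: w') false * G (string_partition u))).
  apply: eq_bigr => a _.
  under [RHS]eq_bigr => m _ do rewrite mulr_sumr.
  rewrite [RHS]exchange_big; apply: eq_bigr => u _.
  by rewrite /= mulr_suml; apply: eq_bigr => m _; rewrite mulrA.
elim: w => [|b w IH] G.
  rewrite (sum_tuple0 (fun u => aut (hstrip_step x) false u [::] false * G (string_partition u))).
  rewrite (sum_tuple0 (fun u => aut (hstrip_step x) true u [::] false * G (string_partition u))).
  by rewrite /= big_seq1 /weight /= big_geq // ?mul0r ?expr0 ?mul1r.
have IHz i : \sum_(u : (size w).-tuple bool)
      aut (hstrip_step x) i u w false * G (string_partition (true :: u))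
    = \sum_(u : (size w).-tuple bool)
      aut (hstrip_step x) i u w false * G ((zeros w - i)%N :: string_partition u).
  apply: eq_bigr => u _.
  have [->|/aut_hstrip_zeros <-] := eqVneq (aut (hstrip_step x) i u w false) 0.
    by rewrite !mul0r.
  by rewrite addnK.
have [IHf IHt] := IH G.
have [IHf' IHt'] := IH (fun mu => G (zeros w :: mu)).
have hw := head_string_partition w.
case: b; rewrite [size _]/= !sumE !sum_bool /= !IHz subn0 ?IHf ?IHt ?IHf' !mul0r !add0r ?addr0 !mul1r.
  split; last by rewrite big_geq ?addr0.
  rewrite big_hshapes_cons // big_nat_recr //= addrC; congr (_ + _).
    rewrite mulr_sumr [LHS]big_nat_cond [RHS]big_nat_cond; apply: eq_bigr => m /andP[/andP[_ lt] _].
    rewrite mulr_sumr mulr_sumr big_seq [RHS]big_seq; apply: eq_bigr => mu Hmu.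
    rewrite /weight /= !mulrA -exprS -exprD; congr (_ ^+ _ * _).
    by have := sumn_hshapes (string_partition_sorted w) Hmu; lia.
  apply: eq_bigr => mu _; rewrite /weight /=; congr (_ ^+ _ * _); lia.
split=> //; rewrite big_nat_recr //= addrC; congr (_ + _); last first.
  by rewrite subnn expr0 mul1r.
rewrite mulr_sumr [LHS]big_nat_cond [RHS]big_nat_cond; apply: eq_bigr => m /andP[/andP[_ lt] _].
by rewrite mulrA -exprS; congr (_ ^+ _ * _); rewrite /zeros /= -/(zeros w); lia.
Qed.

Lemma sum_hstrip n w (G : seq nat -> R) : size w = n ->
  \sum_(u : n.-tuple bool) hstrip x u w * G (string_partition u)
  = \sum_(mu <- hshapes (string_partition w))
      x ^+ (sumn (string_partition w) - sumn mu) * G mu.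
Proof. by move=> <-; case: (sum_hstrip_aux w G). Qed.

End Branching.

(** A chain lists its outermost strip first, and that strip carries the largest letter: hence
    [rev]. *)
Lemma tableau_sum_chain (R : comNzRingType) M (y : nat -> R) N n z k w :
  (N <= M)%N -> n = (z + k)%N -> size w = n -> ones w = k ->
  tableau_sum (fun i : 'I_M => y i) N (string_partition w)
  = chain n (@hstrip R) (rev (mkseq y N)) (vac z k) w.
Proof.
move=> leNM En; elim: N leNM w => [|N IH] ltNM w sw ow.
  by rewrite tableau_sum0 (string_partition_vac (z := z) (k := k)) ?sw.
rewrite (tableau_sumS (fun i : 'I_M => y i) ltNM (string_partition_sorted w) (o := Ordinal ltNM)) //.
rewrite -(sum_hstrip (y N) (tableau_sum (fun i : 'I_M => y i) N) sw).
have -> : rev (mkseq y N.+1) = y N :: rev (mkseq y N).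
  by rewrite /mkseq -addn1 iotaD map_cat rev_cat.
apply: eq_bigr => u _ /=.
have [->|/hstrip_ones ou] := eqVneq (hstrip (y N) u w) 0; first by rewrite mul0r mulr0.
by rewrite mulrC IH ?size_tuple // ?ou // ltnW.
Qed.

Lemma schur_chain (R : comNzRingType) k (f : {rmorphism {mpoly int[k]} -> R})
    (y : nat -> R) n z w :
  (forall i : 'I_k, f 'X_i = y i) -> n = (z + k)%N -> size w = n -> ones w = k ->
  f (schur k (string_partition w)) = chain n (@hstrip R) (rev (mkseq y k)) (vac z k) w.
Proof.
move=> fX En sw ow; rewrite -(tableau_sum_chain y (leqnn k) En sw ow).
rewrite /schur rmorph_sum; apply: eq_big => [T|T _].
  by rewrite andb_idr // => _; apply/forallP => c; apply: ltn_ord.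
by rewrite rmorph_prod; apply: eq_bigr => c _; rewrite fX.
Qed.

(** * Littlewood-Richardson coefficients *)

Lemma tripuz_rmorph (R S : comNzRingType) (f : {rmorphism R -> S}) la mu nu :
  f (tripuz R la mu nu) = tripuz S la mu nu.
Proof.
rewrite /tripuz; move: (map Some la) (map Some (rev mu)) (map Some nu) => l r t.
have stripE h s t' b : f (strip R h s t' b) = strip S h s t' b.
  elim: s t' h => [|y s IH] [|z t'] h /=; rewrite ?rmorph0 //.
    by case: t' => *; rewrite ?rmorph0 // /piece rmorph_nat.
  rewrite rmorph_sum; apply: eq_bigr => g _.
  rewrite rmorph_sum; apply: eq_bigr => h' _.
  by rewrite !rmorphM IH /piece !rmorph_nat.
elim: l r t => [|a l IH] [|b r] t /=; rewrite ?rmorph0 ?rmorph_nat //.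
rewrite rmorph_sum; apply: eq_bigr => s _.
by rewrite rmorphM IH stripE.
Qed.

(** In the fraction field, the variables themselves can be substituted in results proved over a
    field. *)
Lemma mpoly_char0 k n : n.+1%:R != 0 :> {fraction {mpoly int[k]}}.
Proof.
by rewrite -(rmorph_nat (@tofrac {mpoly int[k]})) tofrac_eq0 -mpolyC_nat mpolyC_eq0 Num.Theory.pnatr_eq0.
Qed.

Lemma rat_char0 n : n.+1%:R != 0 :> rat.
Proof. by rewrite Num.Theory.pnatr_eq0. Qed.

Lemma schur_mul n z k (la mu : seq bool) : n = (z + k)%N ->
  size la = n -> size mu = n -> ones la = k -> ones mu = k ->
  schur k (string_partition la) * schur k (string_partition mu)
  = \sum_(nu : (z + n).-tuple bool | ones nu == k)
     tripuz int (nseq z false ++ la) (nseq z false ++ mu) nu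
       *: schur k (string_partition nu).
Proof.
move=> En sl sm ol om.
apply/eqP; rewrite -tofrac_eq; apply/eqP.
pose f : {rmorphism {mpoly int[k]} -> {fraction {mpoly int[k]}}} := @tofrac _.
pose y i : {fraction {mpoly int[k]}} := if insub i is Some j then f 'X_(j : 'I_k) else 0.
have fX (i : 'I_k) : f 'X_i = y i by rewrite /y valK.
rewrite -/(f _) -[RHS]/(f _) rmorphM.
rewrite (schur_chain fX En sl ol) (schur_chain fX En sm om).
rewrite (hchain_mul (mpoly_char0 k) En) ?size_rev ?size_mkseq // rmorph_sum.
rewrite (bigID (fun nu : (z + n).-tuple bool => ones nu == k)) /= [X in _ + X]big1 ?addr0.
  apply: eq_bigr => nu /eqP on.
  rewrite -mul_mpolyC rmorphM (schur_chain fX (z := (z + z)%N) _ (size_tuple nu) on).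
    by rewrite (tripuz_rmorph (@mpolyC k int)) (tripuz_rmorph f).
  by rewrite En addnA.
move=> nu non; have [->|/chain_ones] := eqVneq (chain (z + n) (@hstrip _) (rev (mkseq y k)) (vac (z + z) k) nu) 0.
  by rewrite mulr0.
by rewrite ones_vac => E; rewrite -E eqxx in non.
Qed.

(** * Homogeneity and independence of Schur polynomials *)

Lemma tableau_sum_scale (R : comNzRingType) M (x : 'I_M -> R) c N la :
  tableau_sum (fun i => c * x i) N la = c ^+ sumn la * tableau_sum x N la.
Proof.
rewrite /tableau_sum mulr_sumr; apply: eq_bigr => T _.
rewrite big_split /=; congr (_ * _).
rewrite (prod_cell la (fun _ _ => c)).
under eq_bigr => i _ do rewrite prodr_const_nat subn0.
by rewrite prodrXr sumnE [in RHS](big_nth 0%N).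
Qed.

Lemma chain_scale (R : comNzRingType) (c : R) n z k xs w :
  n = (z + k)%N -> size w = n -> ones w = k -> size xs = k ->
  chain n (@hstrip R) (map ( *%R c) xs) (vac z k) w
  = c ^+ sumn (string_partition w) * chain n (@hstrip R) xs (vac z k) w.
Proof.
move=> En sw ow sxs; pose y i := nth 0 (rev xs) i.
have -> : xs = rev (mkseq y k).
  by rewrite /mkseq -sxs -(size_rev xs) -/(mkseq _ _) mkseq_nth revK.
have -> : map ( *%R c) (rev (mkseq y k)) = rev (mkseq (fun i => c * y i) k).
  by rewrite map_rev /mkseq -map_comp.
rewrite -(tableau_sum_chain y (leqnn k) En sw ow).
rewrite -(tableau_sum_chain (fun i => c * y i) (leqnn k) En sw ow).
exact: (tableau_sum_scale (fun i : 'I_k => y i)).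
Qed.

(** Homogeneity: all variables are rescaled by 2 in [hchain_mul] and coefficients are compared,
    powers of 2 with different exponents being different. *)
Lemma tripuz_degree n z k (la mu nu : seq bool) : n = (z + k)%N ->
  size la = n -> size mu = n -> ones la = k -> ones mu = k ->
  size nu = (z + n)%N -> ones nu = k ->
  sumn (string_partition nu)
    != (sumn (string_partition la) + sumn (string_partition mu))%N ->
  tripuz int (nseq z false ++ la) (nseq z false ++ mu) nu = 0.
Proof.
move=> En sl sm ol om sn on nd.
set d := (_ + _)%N in nd.
pose T w := tripuz rat (nseq z false ++ la) (nseq z false ++ mu) w.
pose c w := T w * (2 ^+ sumn (string_partition w) - 2 ^+ d).
have : c nu = 0.
  apply: (@hchain_free rat rat_char0 (z + n) (z + z) k c) => // [|xs sxs _].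
    by rewrite En addnA.
  have H2 := hchain_mul rat_char0 En (xs := map ( *%R 2) xs) _ sl sm ol om.
  rewrite size_map sxs !(chain_scale _ En) // in H2.
  under eq_bigr => w _ do rewrite /c mulrBr mulrBl.
  rewrite big_split /= sumrN; apply/eqP; rewrite subr_eq0; apply/eqP.
  transitivity (2 ^+ d * (chain n (@hstrip rat) xs (vac z k) la * chain n (@hstrip rat) xs (vac z k) mu)).
    transitivity (2 ^+ sumn (string_partition la) * chain n (@hstrip rat) xs (vac z k) la *
      (2 ^+ sumn (string_partition mu) * chain n (@hstrip rat) xs (vac z k) mu)); last first.
      by rewrite /d exprD; ring.
    rewrite H2 //; apply: eq_bigr => w _; rewrite /T -mulrA; congr (_ * _).
    have En' : (z + n = z + z + k)%N by rewrite En addnA.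
    have [ow|now] := eqVneq (ones w) k.
      by rewrite (chain_scale _ En') ?size_tuple.
    have c0 ys : chain (z + n) (@hstrip rat) ys (vac (z + z) k) w = 0.
      apply/eqP; apply: contraNT now => /chain_ones; rewrite ones_vac => <-.
      by rewrite eqxx.
    by rewrite !c0 mulr0.
  by rewrite (hchain_mul rat_char0 En) // mulr_sumr; apply: eq_bigr => w _; rewrite /T; ring.
move/eqP; rewrite mulf_eq0 subr_eq0 => /orP[|/eqP E].
  by rewrite /T -(tripuz_rmorph (intr : {rmorphism int -> rat})) intr_eq0 => /eqP.
by case/eqP: nd; apply: (Num.Theory.ieexprIn (x := 2 : rat)) E.
Qed.

Lemma sumn_ge (s : seq nat) i : (nth 0%N s i <= sumn s)%N.
Proof.
have [lt|ge] := ltnP i (size s); last by rewrite nth_default.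
by rewrite sumnE (big_nth 0%N) (bigD1_seq i) ?mem_index_iota ?iota_uniq //= leq_addr.
Qed.

Lemma sum_partition_tuple (R : nmodType) k d (q : seq nat) (x : R) :
  is_partition k d q ->
  \sum_(p : k.-tuple 'I_d.+1 | is_partition k d (map val p) && (map val p == q)) x = x.
Proof.
move=> Hq; have /and3P[/eqP sq _ /eqP dq] := Hq.
have sp : size (map (fun a => inord a : 'I_d.+1) q) == k by rewrite size_map sq.
have Ep : map val (Tuple sp) = q.
  rewrite /= -map_comp; apply: map_id_in => a /(nthP 0%N)[i _ <-] /=.
  by rewrite inordK // ltnS -dq sumn_ge.
rewrite (big_pred1 (Tuple sp)) // => p /=.
apply/andP/eqP => [[_ /eqP E]|->]; last by rewrite Ep.
by apply: val_inj; apply: (inj_map val_inj); rewrite E.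
Qed.

Lemma string_partition_inj w w' : zeros w = zeros w' ->
  string_partition w = string_partition w' -> w = w'.
Proof.
elim: w w' => [|b w IH] [|b' w'] //.
- by case: b'.
- by case: b.
have hw := head_string_partition w; have hw' := head_string_partition w'.
case: b b' => [] []; rewrite /zeros /= -/(zeros w) -/(zeros w').
- by move=> Ez [_ Ep]; rewrite (IH w').
- by move=> Ez Ep; move: hw'; rewrite -Ep /=; lia.
- by move=> Ez Ep; move: hw; rewrite Ep /=; lia.
by move=> [Ez] Ep; rewrite (IH w').
Qed.

Fixpoint partition_string (m : nat) (q : seq nat) : seq bool :=
  if q is a :: q' then nseq (m - a) false ++ true :: partition_string a q'
  else nseq m false.

Lemma partition_stringP m q : path geq m q ->
  [/\ string_partition (partition_string m q) = q,
      zeros (partition_string m q) = m & ones (partition_string m q) = size q].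
Proof.
have p0 a u : string_partition (nseq a false ++ u) = string_partition u by elim: a.
elim: q m => [|a q IH] m /=.
  by rewrite -[nseq m false]cats0 p0 zeros_cat ones_cat zeros_nseq ones_nseq /=;
    split=> //; rewrite ?mul1n ?addn0.
case/andP=> am /IH[E1 E2 E3]; rewrite p0 /= E1 E2 zeros_cat ones_cat zeros_nseq ones_nseq.
rewrite /zeros /= -/(zeros _) E2 /ones /= -/(ones _) E3 mul1n mul0n.
by split=> //; rewrite subnK.
Qed.

(** The parts of a partition of [d] are at most [d], so all these partitions come from strings with
    [d] zeros and [k] ones, and [hchain_free] applies after evaluation at rational points. *)
Lemma schur_free k d (c : seq nat -> int) :
  \sum_(p : k.-tuple 'I_d.+1 | is_partition k d (map val p))
     c (map val p) *: schur k (map val p) = 0 ->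
  forall q, is_partition k d q -> c q = 0.
Proof.
move=> H0 q Hq; have /and3P[/eqP sq srt /eqP dq] := Hq.
have strP p : is_partition k d p -> path geq d p.
  case/and3P=> _ sp /eqP dp; case: p sp dp => //= a p -> <-.
  by rewrite andbT leq_addr.
have [E1 E2 E3] := partition_stringP (strP q Hq).
set w := partition_string d q in E1 E2 E3.
have En : (d + k = d + k)%N by [].
pose c' u : rat := if sumn (string_partition u) == d then (c (string_partition u))%:~R else 0.
have : c' w = 0.
  apply: (@hchain_free rat rat_char0 (d + k) d k c') => //; last first.
  - by rewrite E3.
  - by rewrite -ones_zeros E2 E3 sq addnC.
  move=> xs sxs _.
  pose y i := nth 0 (rev xs) i.
  have Exs : xs = rev (mkseq y k).
    by rewrite /mkseq -sxs -(size_rev xs) -/(mkseq _ _) mkseq_nth revK.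
  pose f : {rmorphism {mpoly int[k]} -> rat} := mmap (intr : int -> rat) (fun i => y i).
  have fX (i : 'I_k) : f 'X_i = y i by rewrite /f /= mmapX mmap1U.
  have fZ a p : f (a *: p) = a%:~R * f p by rewrite /f /= mmapZ.
  have F0 := congr1 f H0; rewrite rmorph0 rmorph_sum in F0; rewrite -[RHS]F0.
  have ptE (p : k.-tuple 'I_d.+1) : is_partition k d (map val p) ->
      f (c (map val p) *: schur k (map val p))
      = \sum_(u : (d + k).-tuple bool | (ones u == k) && (string_partition u == map val p))
         c' u * chain (d + k) (@hstrip rat) xs (vac d k) u.
    move=> Hp; have [F1 F2 F3] := partition_stringP (strP _ Hp).
    have su : size (partition_string d (map val p)) == (d + k)%N.
      by rewrite -ones_zeros F2 F3 size_map size_tuple addnC.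
    rewrite (big_pred1 (Tuple su)) => [|u /=].
      have /and3P[_ _ Hd] := Hp.
      rewrite /c' /= F1 Hd fZ; congr (_ * _); rewrite Exs -{1}F1.
      by apply: (schur_chain fX En (eqP su)); rewrite F3 size_map size_tuple.
    apply/andP/eqP => [[/eqP ou /eqP Eu]|->]; last by rewrite /= F1 F3 size_map size_tuple.
    apply: val_inj => /=; apply: string_partition_inj; last by rewrite F1.
    by rewrite F2; apply: (@addnI k); rewrite -{1}ou ones_zeros size_tuple addnC.
  rewrite [RHS](eq_bigr _ ptE) [RHS](exchange_big_dep (fun u : (d + k).-tuple bool => ones u == k)) /=; last first.
    by move=> p u _ /andP[].
  rewrite [LHS](bigID (fun u : (d + k).-tuple bool => ones u == k)) /= [X in _ + X]big1 ?addr0.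
    apply: eq_bigr => u /eqP ou.
    have [Ed|nd] := eqVneq (sumn (string_partition u)) d; last first.
      by rewrite /c' (negbTE nd) mul0r big1.
    have Hu : is_partition k d (string_partition u).
      by rewrite /is_partition size_string_partition ou eqxx string_partition_sorted Ed /=.
    rewrite -[LHS](sum_partition_tuple _ Hu); apply: eq_bigl => p.
    by rewrite ou eqxx /= eq_sym.
  move=> u now; have [->|/chain_ones] := eqVneq (chain (d + k) (@hstrip rat) xs (vac d k) u) 0.
    by rewrite mulr0.
  by rewrite ones_vac => E; rewrite -E eqxx in now.
rewrite /c' E1 dq eqxx => /eqP; rewrite intr_eq0.
by move/eqP.
Qed.

(** Puzzle numbers of padded strings give one Schur expansion of the product; by [schur_free] it
    agrees with the one chosen by [epsilon]. *)
Lemma LR_tripuz n k (la mu nu : seq bool) :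
  size la = n -> size mu = n -> size nu = n ->
  ones la = k -> ones mu = k -> ones nu = k ->
  LR la mu nu = tripuz int la mu nu.
Proof.
move=> sl sm sn ol om on; pose z := zeros la.
have En : n = (z + k)%N by rewrite -sl -ol addnC ones_zeros.
pose d := (sumn (string_partition la) + sumn (string_partition mu))%N.
pose T u := tripuz int (nseq z false ++ la) (nseq z false ++ mu) u.
pose c q : int := if is_partition k d q then
  \sum_(u : (z + n).-tuple bool | (ones u == k) && (string_partition u == q)) T u else 0.
have Hc : schur_expansion d (schur k (string_partition la) * schur k (string_partition mu)) c.
  split=> [q /negbTE Hq|]; first by rewrite /c Hq.
  rewrite (schur_mul En) //.
  under [RHS]eq_bigr => p Hp do rewrite /c Hp scaler_suml.
  rewrite (exchange_big_dep (fun u : (z + n).-tuple bool => ones u == k)) /=; last first.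
    by move=> p u _ /andP[].
  apply: eq_bigr => u /eqP ou.
  have [Ed|nd] := eqVneq (sumn (string_partition u)) d; last first.
    rewrite /T (tripuz_degree En) ?size_tuple // scale0r big1 // => p _.
    by rewrite scale0r.
  have Hu : is_partition k d (string_partition u).
    by rewrite /is_partition size_string_partition ou eqxx string_partition_sorted Ed /=.
  rewrite -[LHS](sum_partition_tuple _ Hu); apply: eq_big => [p|p /andP[_ /eqP <-] //].
  by rewrite ou eqxx /= eq_sym.
rewrite /LR /LR_partition on -/d.
set e := epsilon _ _.
have He : schur_expansion d (schur k (string_partition la) * schur k (string_partition mu)) e.
  by apply: epsilon_spec; exists c.
have -> : e (string_partition nu) = c (string_partition nu).
  have [Hnu|Hnu] := boolP (is_partition k d (string_partition nu)); last first.
    by rewrite He.1 // Hc.1.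
  apply/eqP; rewrite -subr_eq0; apply/eqP.
  apply: (@schur_free k d (fun q => e q - c q)) => //.
  under eq_bigr => p _ do rewrite scalerBl.
  by rewrite big_split /= sumrN -He.2 -Hc.2 subrr.
have Tnu : T (nseq z false ++ nu) = tripuz int la mu nu.
  apply/eqP; rewrite -(inj_eq (intr_inj (R := rat))) !(tripuz_rmorph (intr : {rmorphism int -> rat})).
  by rewrite (tripuz_pad rat_char0 En).
have p0 a u : string_partition (nseq a false ++ u) = string_partition u by elim: a.
have snu : size (nseq z false ++ nu) == (z + n)%N by rewrite size_cat size_nseq sn.
rewrite -Tnu /c; case: ifPn => Hnu.
  rewrite (big_pred1 (Tuple snu)) // => u /=.
  apply/andP/eqP => [[/eqP ou /eqP Eu]|->]; last by rewrite /= p0 ones_cat ones_nseq on.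
  apply: val_inj => /=; apply: string_partition_inj; last by rewrite p0.
  apply: (@addnI k); rewrite -{1}ou ones_zeros size_tuple zeros_cat zeros_nseq mul1n.
  by rewrite addnCA -[k in RHS]on ones_zeros sn.
(* When the degrees differ, [c] is 0 by definition and the puzzle number by homogeneity. *)
rewrite /T (tripuz_degree En) ?size_cat ?size_nseq ?sn ?ones_cat ?ones_nseq ?on //.
apply: contraNneq Hnu; rewrite p0 => Ed.
by rewrite /is_partition size_string_partition on eqxx string_partition_sorted Ed /=.
Qed.

(** * Counting puzzles row by row *)

Lemma sum_only (R : nmodType) (I : finType) (i : I) (G : I -> R) :
  (forall j, j != i -> G j = 0) -> \sum_j G j = G i.
Proof. by move=> H; rewrite (bigD1 i) //= big1 ?addr0. Qed.

Section EdgeLabels.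
Variables (n : nat) (P : {ffun edge n -> label}).

(** A total function of the coordinates; for the three directions, the default is returned only
    outside the triangle. *)
Definition edge_label (d x y : nat) : label :=
  if [pick e : edge n | edge_at e d x y] is Some e then P e else lab10.

Lemma edge_at_label (e : edge n) d x y : edge_at e d x y -> edge_label d x y = P e.
Proof.
move=> He; rewrite /edge_label; case: pickP => [e' He'|/(_ e)]; last by rewrite He.
congr (P _); apply: val_inj.
case/and3P: He => /eqP E1 /eqP E2 /eqP E3; case/and3P: He' => /eqP F1 /eqP F2 /eqP F3.
move: E1 E2 E3 F1 F2 F3; case: (val e) (val e') => [d1 [x1 y1]] [d2 [x2 y2]] /= <- <- <-.
by move=> /val_inj -> /val_inj -> /val_inj ->.
Qed.

End EdgeLabels.

Lemma edge_exists n d x y : (d < 3)%N -> (x + y < n)%N -> exists e : edge n, edge_at e d x y.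
Proof.
move=> d3 xy.
have xn : (x < n)%N by apply: leq_ltn_trans xy; apply: leq_addr.
have yn : (y < n)%N by apply: leq_ltn_trans xy; apply: leq_addl.
by exists (exist _ (Ordinal d3, (Ordinal xn, Ordinal yn)) xy); rewrite /edge_at /= !eqxx.
Qed.

Lemma edge_at_bound n (e : edge n) d x y : edge_at e d x y -> (d < 3)%N /\ (x + y < n)%N.
Proof.
case/and3P=> /eqP <- /eqP <- /eqP <-; split; first exact: ltn_ord.
exact: (valP e).
Qed.

(* The left and right sides are read from the bottom up, the South side from left
   to right. *)
Definition good_puzzle n (l r t : seq label) (P : {ffun edge n -> label}) : bool :=
  [&& [forall x : 'I_n, [&& edge_label P 1 0 x == nth lab10 l x,
          edge_label P 2 (n - x.+1) x == nth lab10 r x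
        & edge_label P 0 x 0 == nth lab10 t x]],
      [forall x : 'I_n, forall y : 'I_n, (x + y < n)%N ==>
        allowed (edge_label P 1 x y) (edge_label P 2 x y) (edge_label P 0 x y)]
    & [forall x : 'I_n, forall y : 'I_n, (x + y.+1 < n)%N ==>
        allowed (edge_label P 0 x y.+1) (edge_label P 1 x.+1 y) (edge_label P 2 x y)]].

Lemma good_puzzleP n l r t (P : {ffun edge n -> label}) :
  reflect [/\ forall x, (x < n)%N -> [/\ edge_label P 1 0 x = nth lab10 l x,
          edge_label P 2 (n - x.+1) x = nth lab10 r x
        & edge_label P 0 x 0 = nth lab10 t x],
      forall x y, (x + y < n)%N ->
        allowed (edge_label P 1 x y) (edge_label P 2 x y) (edge_label P 0 x y)
    & forall x y, (x + y.+1 < n)%N ->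
        allowed (edge_label P 0 x y.+1) (edge_label P 1 x.+1 y) (edge_label P 2 x y)]
  (good_puzzle l r t P).
Proof.
apply: (iffP and3P) => [[/forallP H1 /forallP H2 /forallP H3]|[H1 H2 H3]]; split.
- by move=> x lt; have /and3P[/eqP E1 /eqP E2 /eqP E3] := H1 (Ordinal lt).
- move=> x y lt; have lx : (x < n)%N by lia.
  have ly : (y < n)%N by lia.
  by have /forallP/(_ (Ordinal ly))/implyP := H2 (Ordinal lx); apply.
- move=> x y lt; have lx : (x < n)%N by lia.
  have ly : (y < n)%N by lia.
  by have /forallP/(_ (Ordinal ly))/implyP := H3 (Ordinal lx); apply.
- by apply/forallP => x; have [-> -> ->] := H1 x (ltn_ord x); rewrite !eqxx.
- by apply/forallP => x; apply/forallP => y; apply/implyP; apply: H2.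
- by apply/forallP => x; apply/forallP => y; apply/implyP; apply: H3.
Qed.

Lemma up_okP n (P : {ffun edge n -> label}) :
  reflect (forall x y, (x + y < n)%N ->
    allowed (edge_label P 1 x y) (edge_label P 2 x y) (edge_label P 0 x y)) (up_ok P).
Proof.
apply: (iffP idP) => [/forallP H x y lt|H].
  have lx : (x < n)%N by lia.
  have ly : (y < n)%N by lia.
  have [e1 E1] := edge_exists (isT : 1 < 3)%N lt.
  have [e2 E2] := edge_exists (isT : 2 < 3)%N lt.
  have [e3 E3] := edge_exists (isT : 0 < 3)%N lt.
  have /forallP/(_ (Ordinal ly))/forallP/(_ e1)/forallP/(_ e2)/forallP/(_ e3)/implyP := H (Ordinal lx).
  rewrite /= E1 E2 E3 => /(_ isT).
  by rewrite (edge_at_label P E1) (edge_at_label P E2) (edge_at_label P E3).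
apply/forallP => x; apply/forallP => y; apply/forallP => e1; apply/forallP => e2.
apply/forallP => e3; apply/implyP => /and3P[E1 E2 E3].
rewrite -(edge_at_label P E1) -(edge_at_label P E2) -(edge_at_label P E3).
by apply: H; case: (edge_at_bound E1).
Qed.

Lemma down_okP n (P : {ffun edge n -> label}) :
  reflect (forall x y, (x + y.+1 < n)%N ->
    allowed (edge_label P 0 x y.+1) (edge_label P 1 x.+1 y) (edge_label P 2 x y)) (down_ok P).
Proof.
apply: (iffP idP) => [/forallP H x y lt|H].
  have lx : (x < n)%N by lia.
  have ly : (y < n)%N by lia.
  have [e1 E1] := edge_exists (isT : 0 < 3)%N lt.
  have [e2 E2] := edge_exists (isT : 1 < 3)%N (eq_ind_r (fun m => m < n)%N lt (addSnnS x y)).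
  have [e3 E3] := edge_exists (isT : 2 < 3)%N (ltnW (eq_ind_r (fun m => m < n)%N lt (addSnnS x y)) : x + y < n)%N.
  have /forallP/(_ (Ordinal ly))/forallP/(_ e1)/forallP/(_ e2)/forallP/(_ e3)/implyP := H (Ordinal lx).
  rewrite /= E1 E2 E3 => /(_ isT).
  by rewrite (edge_at_label P E1) (edge_at_label P E2) (edge_at_label P E3).
apply/forallP => x; apply/forallP => y; apply/forallP => e1; apply/forallP => e2.
apply/forallP => e3; apply/implyP => /and3P[E1 E2 E3].
rewrite -(edge_at_label P E1) -(edge_at_label P E2) -(edge_at_label P E3).
by apply: H; case: (edge_at_bound E1).
Qed.

Lemma boundary_okP n (la mu nu : seq bool) (P : {ffun edge n -> label}) :
  size la = n -> size mu = n -> size nu = n ->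
  reflect (forall x, (x < n)%N ->
     [/\ edge_label P 1 0 x = nth lab10 (map Some la) x,
          edge_label P 2 (n - x.+1) x = nth lab10 (map Some (rev mu)) x
        & edge_label P 0 x 0 = nth lab10 (map Some (rev nu)) x])
   (boundary_ok la mu nu P).
Proof.
move=> sl sm sn.
have nthS (w : seq bool) x : size w = n -> (x < n)%N ->
    nth lab10 (map Some w) x = Some (nth false w x).
  by move=> sw lt; rewrite (nth_map false) ?sw.
apply: (iffP idP) => [/forallP H x lt|H].
  (* [boundary_ok] indexes the NE and South sides clockwise, so the entry [x] counted from the other
     end has index [n - x.+1]. *)
  have xx : (n - x.+1 < n)%N by lia.
  have lt' : (n - x.+1 + x < n)%N by lia.
  rewrite !nthS ?size_rev // !nth_rev ?sm ?sn //.
  have [e1 E1] := edge_exists (isT : 1 < 3)%N (lt : 0 + x < n)%N.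
  have [e2 E2] := edge_exists (isT : 2 < 3)%N lt'.
  have [e3 E3] := edge_exists (isT : 0 < 3)%N (eq_ind_r (fun m => m < n)%N lt (addn0 x)).
  rewrite (edge_at_label P E1) (edge_at_label P E2) (edge_at_label P E3); split.
  - by have /forallP/(_ e1)/and3P[/implyP/(_ E1)/eqP -> _ _] := H (Ordinal lt).
  - have /forallP/(_ e2)/and3P[_ /implyP K _] := H (Ordinal xx).
    by apply/eqP/K; rewrite /= (_ : n - (n - x.+1).+1 = x)%N //; lia.
  - have /forallP/(_ e3)/and3P[_ _ /implyP K] := H (Ordinal xx).
    by apply/eqP/K; rewrite /= (_ : n - (n - x.+1).+1 = x)%N //; lia.
apply/forallP => i; apply/forallP => e.
have li : (n - i.+1 < n)%N by have := ltn_ord i; lia.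
have iE : (n - (n - i.+1).+1 = i)%N by have := ltn_ord i; lia.
apply/and3P; split; apply/implyP => He; rewrite -(edge_at_label P He).
- by have [-> _ _] := H i (ltn_ord i); rewrite nthS.
- have [_ K _] := H _ li; move: K; rewrite iE => ->.
  by rewrite nthS ?size_rev // nth_rev ?sm // iE.
- have [_ _ ->] := H _ li.
  by rewrite nthS ?size_rev // nth_rev ?sn // iE.
Qed.

Lemma Tri_good n (la mu nu : seq bool) : size la = n -> size mu = n -> size nu = n ->
  Tri la mu nu = #|[set P : {ffun edge n -> label} |
     good_puzzle (map Some la) (map Some (rev mu)) (map Some (rev nu)) P]|.
Proof.
move=> sl sm sn; rewrite /Tri sl sm sn eqxx /=; apply: eq_card => P; rewrite !inE.
apply/and3P/good_puzzleP => [[/boundary_okP H1 /up_okP H2 /down_okP H3]|[H1 H2 H3]].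
  by split=> //; apply: H1.
by split; [apply/boundary_okP | apply/up_okP | apply/down_okP].
Qed.

Section Count.
Variable R : comNzRingType.

(** [h] and [g] are the NW and NE labels of the up triangles in a row with top [s] and bottom
    [t]. *)
Definition strip_ok (s t h g : seq label) : bool :=
  all (fun x => allowed (nth lab10 h x) (nth lab10 g x) (nth lab10 t x))
    (iota 0 (size s).+1)
  && all (fun x => allowed (nth lab10 s x) (nth lab10 h x.+1) (nth lab10 g x))
    (iota 0 (size s)).

Lemma all_iotaS (Q : pred nat) m :
  all Q (iota 0 m.+1) = Q 0%N && all (fun x => Q x.+1) (iota 0 m).
Proof. by rewrite /= -[1%N]addn0 iotaDl all_map. Qed.

Lemma strip_ok_cons y s z t a h1 h g0 g :
  strip_ok (y :: s) (z :: t) [:: a, h1 & h] (g0 :: g)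
  = [&& allowed a g0 z, allowed y h1 g0 & strip_ok s t (h1 :: h) g].
Proof.
rewrite /strip_ok [size _]/= (all_iotaS _ (size s).+1) [X in _ && X = _]all_iotaS.
by rewrite -[LHS]andbA; congr (_ && _); rewrite andbCA.
Qed.

Lemma strip_count n a s t b : size s = n -> size t = n.+1 ->
  strip R a s t b = \sum_(h : n.-tuple label) \sum_(g : n.+1.-tuple label)
    (strip_ok s t (a :: h) g && (nth lab10 g n == b))%:R.
Proof.
move=> <-; elim: s t a => [|y s IH] [|z t] a // [st].
  case: t st => // _.
  rewrite (sum_tuple0 (fun h => \sum_(g : 1.-tuple label)
    (strip_ok [::] [:: z] (a :: h) g && (nth lab10 g 0 == b))%:R)).
  rewrite (sum_tupleS _ (fun g => (strip_ok [::] [:: z] [:: a] g && (nth lab10 g 0 == b))%:R)).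
  under eq_bigr => c _ do rewrite
    (sum_tuple0 (fun g => (strip_ok [::] [:: z] [:: a] (c :: g) && (nth lab10 (c :: g) 0 == b))%:R)).
  rewrite /= /strip_ok /= (bigD1 b) //= !eqxx !andbT big1 ?addr0 // => c /negbTE ->.
  by rewrite andbF.
rewrite [size _]/= strip_cons exchange_big /=.
rewrite (sum_tupleS _ (fun h => \sum_(g : (size s).+2.-tuple label)
   (strip_ok (y :: s) (z :: t) (a :: h) g && (nth lab10 g (size s).+1 == b))%:R)).
apply: eq_bigr => h1 _.
under [RHS]eq_bigr => h _ do rewrite (sum_tupleS _ (fun g =>
   (strip_ok (y :: s) (z :: t) [:: a, h1 & h] g && (nth lab10 g (size s).+1 == b))%:R)).
rewrite [RHS]exchange_big /=; apply: eq_bigr => g0 _.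
rewrite IH // mulr_sumr; apply: eq_bigr => h _; rewrite mulr_sumr; apply: eq_bigr => g _.
by rewrite /piece -!natrM !mulnb strip_ok_cons -!andbA.
Qed.

End Count.

Section Peel.
Variable n : nat.
Local Notation P0 := {ffun edge n -> label}.
Local Notation P1 := {ffun edge n.+1 -> label}.
Local Notation word := (n.+1.-tuple label).

Definition bottom_row (t h g : seq label) (d : nat) : seq label :=
  if d is d'.+1 then (if d' is 0%N then h else g) else t.

(** The bottom row is given by the words of its South, NW and NE edges; the rest is a smaller puzzle
    moved up by one. *)
Definition glue (q : P0 * (word * (word * word))) : P1 :=
  [ffun e : edge n.+1 =>
     if nat_of_ord (val e).2.2 is y.+1 then edge_label q.1 (val e).1 (val e).2.1 y
     else nth lab10 (bottom_row q.2.1 q.2.2.1 q.2.2.2 (val e).1) (val e).2.1].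

Definition unglue (P : P1) : P0 * (word * (word * word)) :=
  let b d := [tuple edge_label P d x 0 | x < n.+1] in
  ([ffun e : edge n => edge_label P (val e).1 (val e).2.1 (val e).2.2.+1],
    (b 0%N, (b 1%N, b 2%N))).

Lemma edge_label_glue q d x y : (d < 3)%N -> (x + y < n.+1)%N ->
  edge_label (glue q) d x y = if y is y'.+1 then edge_label q.1 d x y'
     else nth lab10 (bottom_row q.2.1 q.2.2.1 q.2.2.2 d) x.
Proof.
move=> d3 xy; have [e He] := edge_exists d3 xy.
rewrite (edge_at_label _ He) ffunE.
by case/and3P: He => /eqP <- /eqP <- /eqP <-.
Qed.

Lemma glueK : cancel glue unglue.
Proof.
move=> [P [t [h g]]]; congr (_, (_, (_, _))).
  apply/ffunP => e; rewrite ffunE edge_label_glue ?ltn_ord //=.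
    by apply: edge_at_label; rewrite /edge_at !eqxx.
  by rewrite addnS ltnS; apply: (valP e).
all: apply: eq_from_tnth => x; rewrite tnth_mktuple edge_label_glue ?addn0 //=.
all: by rewrite (tnth_nth lab10).
Qed.

Lemma unglueK : cancel unglue glue.
Proof.
move=> P; apply/ffunP => e; rewrite ffunE.
have He : edge_at e (val e).1 (val e).2.1 (val e).2.2 by rewrite /edge_at !eqxx.
have [d3 xy] := edge_at_bound He.
rewrite -[RHS](edge_at_label P He).
move: d3 xy; case: (val e) => [d [x [[|y] ly]]] /= d3 xy.
  have nthE d' : nth lab10 [tuple edge_label P d' x 0 | x < n.+1] x = edge_label P d' x 0.
    by rewrite -tnth_nth tnth_mktuple.
  by case: d d3 => [[|[|[|d]]] ld] //= _; rewrite nthE.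
have xy' : (x + y < n)%N by rewrite -ltnS -addnS.
have [e' He'] := edge_exists d3 xy'.
rewrite (edge_at_label _ He') ffunE.
by case/and3P: He' => /eqP -> /eqP -> /eqP ->.
Qed.

Definition south_side (P : P0) : n.-tuple label :=
  [tuple edge_label P 0 x 0 | x < n].

Lemma nth_south_side P x : (x < n)%N -> nth lab10 (south_side P) x = edge_label P 0 x 0.
Proof. by move=> lt; rewrite -[x]/(val (Ordinal lt)) -tnth_nth tnth_mktuple. Qed.

Lemma good_glue a l b r t P (t0 h g : word) : size l = n -> size r = n -> size t = n.+1 ->
  good_puzzle (a :: l) (b :: r) t (glue (P, (t0, (h, g))))
  = [&& t0 == t :> seq label, nth lab10 h 0 == a, nth lab10 g n == b,
        strip_ok (south_side P) t0 h g & good_puzzle l r (south_side P) P].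
Proof.
move=> sl sr st.
have sE := @nth_south_side P.
have lab d x y : (d < 3)%N -> (x + y < n.+1)%N -> edge_label (glue (P, (t0, (h, g)))) d x y
    = if y is y'.+1 then edge_label P d x y' else nth lab10 (bottom_row t0 h g d) x.
  exact: edge_label_glue.
apply/good_puzzleP/idP => [[H1 H2 H3]|/and5P[/eqP Et /eqP Eh /eqP Eg Hs /good_puzzleP[H1 H2 H3]]].
  apply/and5P; split.
  - apply/eqP/(@eq_from_nth _ lab10); rewrite size_tuple ?st // => x lt.
    by have [_ _ E] := H1 x lt; move: E; rewrite lab ?addn0.
  - by have [E _ _] := H1 0%N isT; move: E; rewrite lab // => /= ->.
  - by have [_ E _] := H1 0%N isT; move: E; rewrite subn1 lab ?addn0 // => /= ->.
  - apply/andP; split; apply/allP => x; rewrite mem_iota size_tuple add0n => /andP[_ lt].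
      have lt' : (x + 0 < n.+1)%N by rewrite addn0.
      by have := H2 x 0%N lt'; rewrite !lab //.
    have x1 : (x + 1 < n.+1)%N by rewrite addn1.
    have x0 : (x + 0 < n.+1)%N by rewrite addn0 leqW.
    have x2 : (x.+1 + 0 < n.+1)%N by rewrite addn0.
    by have := H3 x 0%N x1; rewrite !lab //= sE.
  apply/good_puzzleP; split.
  - move=> x lt; have [E1 E2 _] := H1 x.+1 lt; move: E1 E2.
    rewrite !lab //=; last by rewrite subSS; lia.
    by rewrite subSS sE // => -> ->.
  - move=> x y lt; have lt' : (x + y.+1 < n.+1)%N by rewrite addnS.
    by have := H2 x y.+1 lt'; rewrite !lab //.
  - move=> x y lt; have lt1 : (x + y.+2 < n.+1)%N by rewrite addnS.
    have lt2 : (x.+1 + y.+1 < n.+1)%N by rewrite addSnnS.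
    have lt3 : (x + y.+1 < n.+1)%N by apply: leqW.
    by have := H3 x y.+1 lt1; rewrite !lab //.
have /andP[/allP Hs1 /allP Hs2] := Hs.
split.
- case=> [|x] lt.
    by rewrite !lab ?subn1 ?addn0 //= Eh Eg Et.
  have [K1 K2 _] := H1 x lt.
  rewrite !lab ?addn0 //=; last by rewrite subSS; lia.
  by rewrite subSS K1 K2 Et.
- move=> x [|y] lt.
    rewrite !lab //=; apply: Hs1; rewrite mem_iota size_tuple add0n.
    by rewrite addn0 in lt.
  by rewrite !lab //=; apply: H2; move: lt; rewrite addnS.
move=> x [|y] lt; rewrite !lab //=; try lia.
  have lt' : (x < n)%N by lia.
  by rewrite -sE //; apply: Hs2; rewrite mem_iota size_tuple.
by apply: H3; move: lt; rewrite addnS.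
Qed.

End Peel.

Lemma card_good (R : comNzRingType) n (l r t : seq label) :
  size l = n -> size r = n -> size t = n ->
  #|[set P : {ffun edge n -> label} | good_puzzle l r t P]|%:R = puz R l r t.
Proof.
move=> sl sr st; rewrite -sum1_card natr_sum.
under eq_bigl => P do rewrite inE.
rewrite big_mkcond /=; under eq_bigr => P _ do rewrite -mulrb.
elim: n l r t sl sr st => [|n IH] [|a l] [|b r] t // sl sr st.
  have noe (e : edge 0) : False by case: (val e) => [_ [[]]].
  rewrite (big_pred1 [ffun => lab10]) => [|P /=].
    rewrite /= (_ : t == [::]); last by case: t st.
    rewrite (_ : good_puzzle _ _ _ _) //; apply/good_puzzleP.
    by split=> // [x y|x y]; rewrite ltn0.
  by apply/esym/eqP/ffunP => e; case: (noe e).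
move: sl sr => [sl] [sr].
rewrite (reindex (@glue n)); last first.
  by exists (@unglue n) => q _; [apply: glueK | apply: unglueK].
rewrite /= sl.
transitivity (\sum_(P : {ffun edge n -> label}) \sum_(s : n.-tuple label)
   (good_puzzle l r s P)%:R * strip R a s t b); last first.
  rewrite exchange_big /=; apply: eq_bigr => s _.
  by rewrite -mulr_suml IH ?size_tuple.
rewrite -(pair_bigA _ (fun P w => (good_puzzle (a :: l) (b :: r) t (glue (P, w)))%:R)) /=.
apply: eq_bigr => P _.
(* The word between the bottom row and the rest is determined by [P]. *)
rewrite [RHS](sum_only (i := south_side P)); last first.
  move=> s' ns; case: good_puzzleP => [[H _ _]|]; last by rewrite mul0r.
  case/eqP: ns; apply: eq_from_tnth => x; rewrite tnth_mktuple.
  by have [_ _ ->] := H x (ltn_ord x); rewrite -tnth_nth.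
rewrite (strip_count R a b (size_tuple _) st) sum_pair.
rewrite (sum_only (i := Tuple (introT eqP st))); last first.
  move=> t0 nt; rewrite big1 // => -[h g] _; rewrite good_glue //.
  by case: eqP => //= E; case/eqP: nt; apply: val_inj.
rewrite sum_pair.
have glueE (h g : n.+1.-tuple label) :
    good_puzzle (a :: l) (b :: r) t (glue (P, (Tuple (introT eqP st), (h, g))))
    = [&& nth lab10 h 0 == a, nth lab10 g n == b, strip_ok (south_side P) t h g
      & good_puzzle l r (south_side P) P].
  by rewrite good_glue // eqxx.
under eq_bigr => h _ do under eq_bigr => g _ do rewrite glueE.
rewrite (sum_tupleS _ (fun h => \sum_(g : n.+1.-tuple label)
   ([&& nth lab10 h 0 == a, nth lab10 g n == b, strip_ok (south_side P) t h g
      & good_puzzle l r (south_side P) P])%:R)).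
rewrite (sum_only (i := a)) => [|c /negbTE ca]; last first.
  by rewrite big1 // => h _; rewrite big1 // => g _; rewrite [nth _ _ 0]/= ca.
rewrite mulr_sumr; apply: eq_bigr => h _; rewrite mulr_sumr; apply: eq_bigr => g _.
rewrite -natrM mulnb [nth _ (a :: _) 0]/= eqxx; congr (nat_of_bool _)%:R.
by move: (_ == b) (strip_ok _ _ _ _) (good_puzzle _ _ _ _) => [] [] [].
Qed.

Lemma Tri_tripuz n (la mu nu : seq bool) : size la = n -> size mu = n -> size nu = n ->
  (Tri la mu nu)%:R = tripuz int la mu (rev nu).
Proof.
by move=> sl sm sn; rewrite (Tri_good sl sm sn) card_good ?size_map ?size_rev.
Qed.

Theorem proposition4 (a0 a1 c0 c1 : nat)
    (alpha beta : (a0 + a1).-tuple bool) (gamma delta : (c0 + c1).-tuple bool)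
    (nu : ((a0 + a1) + (c0 + c1)).-tuple bool)
    (halpha : alpha \in strings (a0 + a1) a1)
    (hbeta : beta \in strings (a0 + a1) a1)
    (hgamma : gamma \in strings (c0 + c1) c1)
    (hdelta : delta \in strings (c0 + c1) c1)
    (hnu : nu \in strings ((a0 + a1) + (c0 + c1)) (a1 + c1)) :
  ((Tri (alpha ++ gamma) nu (delta ++ beta))%:Z : int) =
  \sum_(la in strings (a0 + a1) a1) \sum_(mu in strings (c0 + c1) c1)
     LR_pad la mu nu * LR alpha la (rev beta) * LR gamma mu (rev delta).
Proof.
have stringsE n k (w : n.-tuple bool) : (w \in strings n k) = (ones w == k).
  by rewrite inE.
have ones_rev w : ones (rev w) = ones w by rewrite /ones count_rev.
move: halpha hbeta hgamma hdelta hnu; rewrite !stringsE.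
move=> /eqP oa /eqP ob /eqP og /eqP od /eqP on.
have zerosE n0 n1 (w : (n0 + n1).-tuple bool) : ones w = n1 -> zeros w = n0.
  by move=> ow; apply: (@addnI n1); rewrite -{1}ow ones_zeros size_tuple addnC.
have zn : zeros nu = (a0 + c0)%N.
  by have := ones_zeros nu; rewrite on size_tuple; lia.
rewrite -natz (Tri_tripuz (n := (a0 + a1 + (c0 + c1))%N)) ?size_cat ?size_tuple //; last first.
  by rewrite addnC.
(* [tripuz_split] is stated over a field; the identity of integers is recovered by injectivity. *)
rewrite rev_cat; apply: (@intr_inj rat).
rewrite (tripuz_rmorph (intr : {rmorphism int -> rat})).
rewrite (tripuz_split rat_char0 (a0 := a0) (a1 := a1) (c0 := c0) (c1 := c1))
  ?size_rev ?size_tuple ?ones_rev //.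
rewrite rmorph_sum; apply: eq_big => [la|la /eqP ol]; first by rewrite stringsE.
rewrite rmorph_sum; apply: eq_big => [mu|mu /eqP om]; first by rewrite stringsE.
have zl := zerosE _ _ _ ol; have zm := zerosE _ _ _ om.
rewrite /LR_pad /pad zn on zl zm ol om addKn addnK addnK addKn.
rewrite [LR (_ ++ _) _ _](LR_tripuz (n := (a0 + a1 + (c0 + c1))%N) (k := (a1 + c1)%N)) ?size_tuple //.
- rewrite (LR_tripuz (n := (a0 + a1)%N) (k := a1)) ?size_rev ?size_tuple ?ones_rev //.
  rewrite (LR_tripuz (n := (c0 + c1)%N) (k := c1)) ?size_rev ?size_tuple ?ones_rev //.
  by rewrite !rmorphM /= !(tripuz_rmorph (intr : {rmorphism int -> rat})).
- by lia.
- by lia.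
- by rewrite !ones_cat !ones_nseq ol; lia.
- by rewrite !ones_cat !ones_nseq om; lia.
Qed.
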